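(* Consider the following robust MDP. States: $\mathcal{S}=\{s_0,s_1,A_0,A_1\}$; actions: $\mathcal{A}=\{T,B\}$; initial state $s_0$. For $k\in\{0,1\}$, $A_k$ is absorbing (for every action) with reward $k$ at every period. In each state $s\in\{s_0,s_1\}$ the adversary chooses a scalar $p\in[0,1]$ (this defines $\mathcal{U}_s$, which is the same for $s_0$ and $s_1$): if action $T$ is chosen, the next state is $A_0$ with probability $p$ and $A_1$ with probability $1-p$; if action $B$ is chosen, the next state is $s_0$ with probability $1-p$ and $s_1$ with probability $p$. For $s\in\{s_0,s_1\}$ the reward of a transition from $s$ to $s_k$ is $k$; the rewards of the transitions from $s$ to $A_0$ or $A_1$ are any values in $\{0,1\}$. The uncertainty set is the resulting polyhedral s-rectangular set $\mathcal{U}=\prod_{s\in\mathcal{S}}\mathcal{U}_s$. Then: (P0) There exists $\boldsymbol{P}\in\mathcal{U}$ such that $R_{\sf avg}(\pi,\boldsymbol{P})\le 1/2$ for every history-dependent policy $\pi\in\Pi_{\sf H}$. (P1) $\max_{\pi\in\Pi_{\sf S}}\inf_{\boldsymbol{P}\in\mathcal{U}}R_{\sf avg}(\pi,\boldsymbol{P})=0$, while $\min_{\boldsymbol{P}\in\mathcal{U}}\max_{\pi\in\Pi_{\sf S}}R_{\sf avg}(\pi,\boldsymbol{P})=\tfrac12$. (P2) $\max_{\pi\in\Pi_{\sf M}}\inf_{\boldsymbol{P}\in\mathcal{U}}R_{\sf avg}(\pi,\boldsymbol{P})=\min_{\boldsymbol{P}\in\mathcal{U}}\max_{\pi\in\Pi_{\sf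 M}}R_{\sf avg}(\pi,\boldsymbol{P})=\tfrac12$.
   Context: A robust MDP (RMDP) is a tuple $(\mathcal{S},\mathcal{A},\boldsymbol{r},\mathcal{U},\boldsymbol{p}_0)$: finite state set $\mathcal{S}$, finite action set $\mathcal{A}$, reward function $\boldsymbol{r}\in\mathbb{R}^{\mathcal{S}\times\mathcal{A}\times\mathcal{S}}$, nonempty compact uncertainty set $\mathcal{U}\subset\Delta(\mathcal{S})^{\mathcal{S}\times\mathcal{A}}$ of transition probabilities $\boldsymbol{P}=(\boldsymbol{p}_{sa})_{s,a}$, and initial distribution $\boldsymbol{p}_0\in\Delta(\mathcal{S})$. The set $\mathcal{U}$ is s-rectangular if $\mathcal{U}=\prod_{s\in\mathcal{S}}\mathcal{U}_s$ with $\mathcal{U}_s\subseteq\Delta(\mathcal{S})^{\mathcal{A}}$. $\Pi_{\sf H}$ is the set of history-dependent, possibly randomized policies (the distribution of the action $a_t$ may depend on $(s_0,a_0,\dots,s_t)$). $\Pi_{\sf M}\subset\Pi_{\sf H}$ is the set of Markovian policies (the distribution of $a_t$ depends only on $t$ and $s_t$). $\Pi_{\sf S}\subset\Pi_{\sf M}$ is the set of stationary policies (the distribution of $a_t$ depends only on $s_t$; randomization allowed). $\boldsymbol{P}\in\mathcal{U}$ is fixed through time (stationary adversary). $\mathbb{E}_{\pi,\boldsymbol{P}}$ is expectation with respect to the law of $(s_t,a_t)_{t\ge0}$ induced by $\pi$ and $\boldsymbol{P}$. The average return is $$R_{\sf avg}(\pi,\boldsymbol{P})=\mathbb{E}_{\pi,\boldsymbol{P}}\Big[\limsup_{T\to+\infty}\tfrac{1}{T+1}\sum_{t=0}^{T}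 r_{s_ta_ts_{t+1}}\ \Big|\ s_0\sim\boldsymbol{p}_0\Big].$$ *)

(* Defs.v *)
From HB Require Import structures.
From mathcomp Require Import all_boot all_order all_algebra.
From mathcomp Require Import all_classical all_reals all_analysis.

Set Implicit Arguments.
Unset Strict Implicit.
Unset Printing Implicit Defensive.

Import Order.TTheory GRing.Theory Num.Theory.
Import numFieldTopology.Exports.

Local Open Scope classical_set_scope.
Local Open Scope ring_scope.

#[short(type="pointedFinType")]
HB.structure Definition PointedFinite := {X of Finite X & isPointed X}.

HB.instance Definition _ (X Y : pointedFinType) :=
  Pointed.on (X * Y)%type.

Record dist (R : realType) (X : finType) := Dist {
  pmf :> X -> R;
  pmf_ge0 : forall x, 0 <= pmf x;
  pmf_sum1 : \sum_x pmf x = 1 }.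

Section dist_dirac.
Variables (R : realType) (X : finType) (x : X).

Lemma dirac_ge0 (y : X) : 0 <= (y == x)%:R :> R.
Proof. exact: ler0n. Qed.

Lemma dirac_sum1 : \sum_y (y == x)%:R = 1 :> R.
Proof.
by rewrite (bigD1 x)//= eqxx big1 ?addr0// => y /negbTE ->.
Qed.

Definition dist_dirac : dist R X := Dist dirac_ge0 dirac_sum1.

End dist_dirac.

Definition cylinder (X : Type) (n : nat) (w : nat -> X) : set (nat -> X) :=
  [set w' | forall i, (i < n)%N -> w' i = w i].

Definition cylinders (X : Type) : set (set (nat -> X)) :=
  [set C | exists n w, C = cylinder n w].

Definition trajType (X : Type) := g_sigma_algebraType (@cylinders X).

HB.instance Definition _ (X : pointedFinType) := Measurable.on (trajType X).


Section ionescu_tulcea.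
Variables (R : realType) (X : pointedFinType).
Implicit Types (p : dist R X) (x y : X) (v : R) (h : seq X) (w : nat -> X).

(* The law is realised on [0, 1[ by iterated inversion of the cumulative
   distribution functions. *)
Let cumul p (k : nat) : R := \sum_(y | (enum_rank y < k)%N) p y.

Let cumulS p x :
  cumul p (enum_rank x).+1 = cumul p (enum_rank x) + p x.
Proof.
rewrite /cumul (bigD1 x)//= addrC; congr (_ + _); apply: eq_bigl => y.
rewrite ltnS ltn_neqAle andbC; congr andb.
by rewrite (inj_eq val_inj) (inj_eq enum_rank_inj).
Qed.

Let cumul_le p (k l : nat) : (k <= l)%N -> cumul p k <= cumul p l.
Proof.
move=> kl; rewrite /cumul big_mkcond [leRHS]big_mkcond/=.
apply: ler_sum => y _; case: ifPn => [yk|_]; last by case: ifP => // _; exact: pmf_ge0.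
by rewrite (leq_trans yk kl).
Qed.

Let cumul0 p : cumul p 0 = 0.
Proof. by rewrite /cumul big_pred0. Qed.

Let cumul_card p : cumul p #|X| = 1.
Proof. by rewrite -(pmf_sum1 p) /cumul; apply: eq_bigl => y; rewrite ltn_ord. Qed.

Let draw p v : X :=
  odflt point [pick x | cumul p (enum_rank x) <= v < cumul p (enum_rank x).+1].

Let drawP p v x : 0 <= v < 1 ->
  draw p v = x <-> cumul p (enum_rank x) <= v < cumul p (enum_rank x).+1.
Proof.
move=> /andP[v0 v1].
have uniq y z : cumul p (enum_rank y) <= v < cumul p (enum_rank y).+1 ->
    cumul p (enum_rank z) <= v < cumul p (enum_rank z).+1 -> y = z.
  move=> /andP[y1 y2] /andP[z1 z2]; apply/enum_rank_inj/val_inj/eqP => /=.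
  by case: ltngtP => // /(cumul_le p) yz; exfalso;
     [have := le_lt_trans z1 y2|have := le_lt_trans y1 z2]; rewrite ltNge yz.
rewrite /draw; case: pickP => [y Hy|none]/=; first by split=> [<-//|]; exact: uniq.
exfalso.
have ex : exists k, v < cumul p k by exists #|X|; rewrite cumul_card.
case: (ex_minnP ex) => -[|k] vk kmin; first by move: vk; rewrite cumul0 ltNge v0.
have kX : (k < #|X|)%N by apply: kmin; rewrite cumul_card.
have := none (enum_val (Ordinal kX)); rewrite enum_valK/= vk andbT => /negbT.
by rewrite -ltNge => /kmin; rewrite ltnn.
Qed.

Variable K : seq X -> dist R X.

Let run := fix run h v (n : nat) : X :=
  let x := draw (K h) v in
  if n is m.+1 then run (rcons h x) ((v - cumul (K h) (enum_rank x)) / K h x) m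
  else x.

Let run_itv n h w : exists lo : R,
  let len := \prod_(t < n) K (h ++ mkseq w t) (w t) in
  [/\ 0 <= lo, lo + len <= 1 & forall v, 0 <= v < 1 ->
    (forall i, (i < n)%N -> run h v i = w i) <-> lo <= v < lo + len].
Proof.
elim: n h w => [|n IH] h w.
  by exists 0; rewrite /= big_ord0 add0r; split.
have [lo [lo0 lo1 loP]] := IH (rcons h (w 0%N)) (fun i => w i.+1).
set p := K h; set x := w 0%N.
rewrite /= big_ord_recl/= /mkseq/= cats0 -/p -/x.
under eq_bigr => i _ do
  rewrite /bump/= add0n -[h ++ _]/(h ++ (x :: map w (iota 1 i))) -cat_rcons
    (iotaDl 1 0) -map_comp.
set L := \prod_(i < n) _.
rewrite -[\prod_(t < n) _]/L in lo1 loP.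
have L0 : 0 <= L by apply: prodr_ge0 => i _; exact: pmf_ge0.
have p0 : 0 <= p x by exact: pmf_ge0.
have c0 : 0 <= cumul p (enum_rank x) by rewrite -(cumul0 p) cumul_le.
have c1 : cumul p (enum_rank x) + p x <= 1.
  by rewrite -cumulS -(cumul_card p) cumul_le// ltn_ord.
have split_run v : (forall i, (i < n.+1)%N -> run h v i = w i) <->
    draw p v = x /\ forall i, (i < n)%N ->
    run (rcons h x) ((v - cumul p (enum_rank x)) / p x) i = w i.+1.
  split=> [H|[H0 H] [|i] ilt//].
    split=> [|i ilt]; first exact: (H 0%N).
    by have := H i.+1 ilt; rewrite /= (_ : draw (K h) v = x)//; exact: (H 0%N).
  by rewrite /= -/p H0; exact: H.
exists (cumul p (enum_rank x) + p x * lo); split.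
- by rewrite addr_ge0// mulr_ge0.
- rewrite -addrA -mulrDr (le_trans _ c1)// lerD2l -[leRHS]mulr1 ler_wpM2l//.
move=> v v01; rewrite split_run drawP// cumulS.
have [px0|pxN0] := eqVneq (p x) 0.
  rewrite px0 !mul0r !addr0; split; first by case.
  by move=> /andP[a b]; have := le_lt_trans a b; rewrite ltxx.
have px : 0 < p x by rewrite lt_neqAle eq_sym pxN0.
set c := cumul _ _ in c0 c1 *.
have eqv : (lo <= (v - c) / p x < lo + L) =
    (c + p x * lo <= v < c + p x * lo + p x * L).
  rewrite ler_pdivlMr// ltr_pdivrMr// lerBrDl ltrBlDl -addrA -mulrDr.
  by rewrite !(mulrC (p x)).
have unit_v : c <= v < c + p x -> 0 <= (v - c) / p x < 1.
  by rewrite ler_pdivlMr// ltr_pdivrMr// mul0r mul1r lerBrDl ltrBlDl addr0.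
split=> [[cv /(loP _ (unit_v cv))]|H]; first by rewrite eqv.
have cv : c <= v < c + p x.
  have /andP[H1 H2] := H; apply/andP; split.
    by rewrite (le_trans _ H1)// lerDl mulr_ge0.
  rewrite (lt_le_trans H2)// -addrA -mulrDr lerD2l -[leRHS]mulr1 ler_wpM2l//.
by split=> //; apply/(loP _ (unit_v cv)); rewrite eqv.
Qed.

Let unitI : set (measurableTypeR R) := `[0, 1[%classic.

Let sample (v : measurableTypeR R) : trajType X :=
  run [::] (if 0 <= v < 1 then v else 0).

Let sample_itv n w : exists lo : R,
  let len := \prod_(t < n) K (mkseq w t) (w t) in
  0 <= len /\ sample @^-1` cylinder n w `&` unitI = `[lo, lo + len[%classic.
Proof.
have [lo [lo0 lo1 loP]] := run_itv n [::] w.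
exists lo; split; first by apply: prodr_ge0 => i _; exact: pmf_ge0.
apply/seteqP; split => v; rewrite /unitI /= !in_itv/=.
  by case=> + v01; rewrite /cylinder /sample/= v01 => /(loP _ v01).
move=> vlo.
have v01 : 0 <= v < 1.
  by have /andP[a b] := vlo; rewrite (le_trans lo0 a) (lt_le_trans b lo1).
by split=> //; rewrite /cylinder /sample/= v01; apply/loP.
Qed.

Let measurable_sample : measurable_fun setT sample.
Proof.
apply: (@measurability _ _ (measurableTypeR R) (trajType X) _ _ (@cylinders X)) => //.
move=> _ [_ [n [w ->]] <-]; rewrite setTI -(setIT (_ @^-1` _)) -(setUv unitI) setIUr.
have munit : measurable unitI by exact: measurable_itv.
apply: measurableU.
  by have [lo [_ ->]] := sample_itv n w; exact: measurable_itv.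
have [w0|w0] := pselect (cylinder n w (run [::] 0)).
  rewrite (_ : _ `&` _ = ~` unitI); first exact: measurableC.
  apply/seteqP; split=> [v []//|v vI]; split=> //.
  rewrite /preimage/= /sample ifF//; apply/negbTE/negP => v01.
  by apply: vI; rewrite /unitI/= in_itv.
rewrite (_ : _ `&` _ = set0)//; apply/seteqP; split=> // v [+ vI].
rewrite /preimage/= /sample ifF//; apply/negbTE/negP => v01.
by apply: vI; rewrite /unitI/= in_itv.
Qed.

Lemma ionescu_tulcea : exists mu : probability (trajType X) R,
  forall n w, mu (cylinder n w) = (\prod_(t < n) K (mkseq w t) (w t))%:E.
Proof.
have munit : measurable unitI by exact: measurable_itv.
pose m := mrestr (@lebesgue_measure R) munit.
have mT : m setT = 1%E.
  by rewrite /m /mrestr setTI lebesgue_measure_itv/= lte_fin ltr01 oppr0 adde0.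
pose P : probability (measurableTypeR R) R :=
  HB.pack m (Measure_isProbability.Build _ _ _ m mT).
pose Z : {mfun measurableTypeR R >-> trajType X} :=
  HB.pack sample (isMeasurableFun.Build _ _ _ _ sample measurable_sample).
exists (distribution P Z) => n w.
rewrite /distribution /pushforward/= /m /mrestr.
have [lo [len0 ->]] := sample_itv n w.
rewrite lebesgue_measure_itv/= lte_fin; case: ifPn.
  by rewrite -EFinB addrAC subrr add0r.
by rewrite ltrDl -leNgt => len1; congr EFin; apply/eqP; rewrite eq_le len0.
Qed.

End ionescu_tulcea.

Lemma cylinder_measure_unique (R : realType) (X : pointedFinType)
    (mu nu : probability (trajType X) R) :
  (forall n w, mu (cylinder n w) = nu (cylinder n w)) ->
  forall E, measurable E -> mu E = nu E.
Proof.
move=> munu E mE; pose G : set (set (nat -> X)) := @cylinders X `|` [set set0].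
have GE : @measurable _ (trajType X) = <<s G >>.
  apply/seteqP; split.
    by apply: sub_sigma_algebra2; exact: subsetUl.
  apply: smallest_sub; first exact: smallest_sigma_algebra.
  move=> C [GC|->]; first exact: sub_sigma_algebra.
  exact: sigma_algebra0.
have cylT : cylinder 0 (fun=> point : X) = setT by apply/seteqP; split.
apply: (@measure_unique _ R (trajType X) G (fun=> setT)) => //.
- move=> _ _ [[n [w ->]]|->] [[m [w' ->]]|->]; rewrite ?set0I ?setI0; try by right.
  have [|/set0P[u [un um]]] := eqVneq (cylinder n w `&` cylinder m w') set0.
    by move=> ->; right.
  left; exists (maxn n m), u; apply/seteqP; split => v.
    move=> [vn vm] i; rewrite leq_max => /orP[] ilt.
      by rewrite vn// un.
    by rewrite vm// um.
  move=> vu; split=> i ilt; rewrite vu ?leq_max ?ilt ?orbT//.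
    by rewrite un.
  by rewrite um.
- by move=> _; left; exists 0%N, (fun=> point); rewrite cylT.
- by rewrite bigcup_const//; exists 0%N.
- by move=> _ [[n [w ->]]|->]; [exact: munu | rewrite !measure0].
- by move=> _; exact: le_lt_trans (probability_le1 mu measurableT) (ltry 1).
Qed.

Section robust_mdp.
Variables (R : realType) (S A : pointedFinType).

Definition transition := S -> A -> dist R S.

Record rmdp := Rmdp {
  reward : S -> A -> S -> R;
  uncert : set transition;
  init : dist R S }.

Definition s_rect_product (Us : S -> set (A -> dist R S)) : set transition :=
  [set P | forall s, Us s (P s)].

(* The list is [:: (s_0, a_0); ...; (s_(t-1), a_(t-1))], and the second
   argument is s_t. *)
Definition policy := seq (S * A) -> S -> dist R A.

Definition markovian : set policy :=
  [set pi | exists f : nat -> S -> dist R A, forall h s, pi h s = f (size h) s].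

Definition stationary : set policy :=
  [set pi | exists f : S -> dist R A, forall h s, pi h s = f s].

Variable M : rmdp.
Implicit Types (P : transition) (pi : policy).

Definition next_state P (h : seq (S * A)) : dist R S :=
  if h is sa :: h' then P (last sa h').1 (last sa h').2 else init M.

Section step.
Variables (pi : policy) (P : transition) (h : seq (S * A)).

Definition step_pmf (sa : S * A) : R := next_state P h sa.1 * pi h sa.1 sa.2.

Lemma step_ge0 sa : 0 <= step_pmf sa.
Proof. by rewrite mulr_ge0// pmf_ge0. Qed.

Lemma step_sum1 : \sum_sa step_pmf sa = 1.
Proof.
rewrite -(pair_bigA _ (fun s a => next_state P h s * pi h s a))/=.
by under eq_bigr do rewrite -big_distrr/= pmf_sum1 mulr1; exact: pmf_sum1.
Qed.

Definition step : dist R (S * A)%type := Dist step_ge0 step_sum1.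

End step.

(* The law of the sequence of the pairs (s_t, a_t); it is characterised by
   traj_lawE, see cylinder_measure_unique. *)
Definition traj_law pi P : probability (trajType (S * A)%type) R :=
  sval (cid (ionescu_tulcea (step pi P))).

Lemma traj_lawE pi P n w : traj_law pi P (cylinder n w) =
  (\prod_(t < n) (next_state P (mkseq w t) (w t).1 *
                  pi (mkseq w t) (w t).1 (w t).2))%:E.
Proof. exact: (svalP (cid (ionescu_tulcea (step pi P)))). Qed.

Definition avg_reward (T : nat) (w : nat -> S * A) : R :=
  (\sum_(t < T.+1) reward M (w t).1 (w t).2 (w t.+1).1) / T.+1%:R.

Definition avg_return pi P : \bar R :=
  (\int[traj_law pi P]_w limn_esup (fun T => (avg_reward T w)%:E))%E.

Definition is_max (E : set (\bar R)) (m : \bar R) := E m /\ ubound E m.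
Definition is_min (E : set (\bar R)) (m : \bar R) := E m /\ lbound E m.

Definition is_max_inf (Pi : set policy) (v : \bar R) :=
  is_max [set ereal_inf [set avg_return pi P | P in uncert M] | pi in Pi] v.

(* The inner maximum is required to be attained for every P in the
   uncertainty set. *)
Definition is_min_max (Pi : set policy) (v : \bar R) :=
  exists2 best : transition -> \bar R,
    forall P, uncert M P -> is_max [set avg_return pi P | pi in Pi] (best P) &
    is_min [set best P | P in uncert M] v.

End robust_mdp.

(* live k is s_k and sink k is A_k, where k is false for 0 and true for 1. *)
Inductive state := live of bool | sink of bool.
Inductive action := actT | actB.

Definition state_code (s : state) : bool + bool :=
  match s with live k => inl k | sink k => inr k end.
Definition state_decode (c : bool + bool) : state :=
  match c with inl k => live k | inr k => sink k end.
Lemma state_codeK : cancel state_code state_decode.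
Proof. by case. Qed.
HB.instance Definition _ := Finite.copy state (can_type state_codeK).
HB.instance Definition _ := isPointed.Build state (live false).

Definition action_code (a : action) : bool := if a is actT then true else false.
Definition action_decode (b : bool) : action := if b then actT else actB.
Lemma action_codeK : cancel action_code action_decode.
Proof. by case. Qed.
HB.instance Definition _ := Finite.copy action (can_type action_codeK).
HB.instance Definition _ := isPointed.Build action actT.

Section counterexample.
Variable R : realType.

Definition live_pmf (p : R) (a : action) (s' : state) : R :=
  match a, s' with
  | actT, sink k => if k then 1 - p else p
  | actB, live k => if k then p else 1 - p
  | _, _ => 0
  end.

Definition local_uncert (s : state) : set (action -> dist R state) :=
  match s with
  | live _ => [set q | exists p : R,
                 0 <= p <= 1 /\ forall a s', q a s' = live_pmf p a s']
  | sink k => [set q | forall a, q a = dist_dirac R (sink k)]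
  end.

(* x i a k is the reward of the transition from s_i to A_k under action a. *)
Definition live_sink_reward := bool -> action -> bool -> bool.

Definition gadget_reward (x : live_sink_reward) (s : state) (a : action)
    (s' : state) : R :=
  match s, s' with
  | sink k, _ => k%:R
  | live _, live k => k%:R
  | live i, sink k => (x i a k)%:R
  end.

Definition gadget (x : live_sink_reward) : rmdp R state action := {|
  reward := gadget_reward x;
  uncert := s_rect_product local_uncert;
  init := dist_dirac R (live false) |}.

End counterexample.

(* Main.v *)
(* Write p_k for the adversary's scalar in s_k and m = p_0 / (1 + p_0 - p_1) for
   the stationary probability of s_1 under B, which is the average reward of
   always playing B.

   For a fixed P, the optimal value is v = max(1 - p_0, 1 - p_1, m) if p_0 > 0
   and 1 if p_0 = 0. It is reached by a pure stationary policy, and v is an upper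
   bound even for history-dependent ones: the martingale counting the visits to
   s_1 has fourth moment at most 4 n^2, so it is o(n) almost surely and the
   average reward tends to m on the event that T is never played. Fatou's lemma
   applied to V(s_t), where V = v on the live states and V = k on A_k is a
   supermartingale, gives the bound. Finally v >= 1/2, with equality at
   p_0 = p_1 = 1/2.

   Against a stationary policy the adversary takes p_0 = 0 if T is never played
   in s_0; otherwise p_0 = 1, and p_1 = 1 or 0 according to whether T is played
   in s_1 or not, which leads to A_0 almost surely.

   The Markovian policy playing B, then T with probability 1/2 at time 1, then B
   forever, is worth (1 - m_2) / 2 + m / 2, where the probability
   m_2 = m (1 - (p_1 - p_0)^2) of being in s_1 at time 2 under B is at most m. *)

Require Import Defs.
From mathcomp Require Import all_boot all_order all_algebra.
From mathcomp Require Import all_classical all_reals all_analysis.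
From mathcomp Require Import measurable_realfun ring lra.

Set Implicit Arguments.
Unset Strict Implicit.
Unset Printing Implicit Defensive.

Import Order.TTheory GRing.Theory Num.Theory.
Import numFieldTopology.Exports numFieldNormedType.Exports.

Local Open Scope classical_set_scope.
Local Open Scope ring_scope.

(** * Expectation of functions of finitely many coordinates *)

Definition adapted {X Y : Type} (n : nat) (F : (nat -> X) -> Y) :=
  forall w w', (forall i, (i < n)%N -> w i = w' i) -> F w = F w'.

Lemma adaptedW {X Y : Type} (m n : nat) (F : (nat -> X) -> Y) :
  (m <= n)%N -> adapted m F -> adapted n F.
Proof. by move=> mn aF w w' ww'; apply: aF => i im; apply: ww'; exact: leq_trans mn. Qed.

Section adapted_expectation.
Variables (R : realType) (X : pointedFinType) (mu : probability (trajType X) R).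
Implicit Types (F G : (nat -> X) -> R) (w : nat -> X).

Lemma measurable_cylinder n w : measurable (cylinder n w : set (trajType X)).
Proof. by apply: sub_sigma_algebra; exists n, w. Qed.

Let ext {n} (u : n.-tuple X) : nat -> X := nth point u.

(** As [X] is finite, there are finitely many words of length [n], so an adapted function is a
    finite combination of indicators of cylinders. It is therefore measurable and integrable with no
    boundedness assumption. *)
Lemma adapted_sum n F : adapted n F ->
  F = fun w => \sum_(u : n.-tuple X) F (ext u) * \1_(cylinder n (ext u)) w.
Proof.
move=> aF; apply/funext => w; have sw : size (mkseq w n) == n by rewrite size_mkseq.
rewrite (bigD1 (Tuple sw))//= big1 ?addr0.
  rewrite indicE mem_set ?mulr1; first by apply: aF => i ilt; rewrite /ext nth_mkseq.
  by move=> i ilt; rewrite /ext nth_mkseq.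
move=> u uw; rewrite indicE memNset ?mulr0// => wu; case/eqP: uw.
apply/val_inj/(@eq_from_nth _ point); rewrite /= size_tuple ?size_mkseq//.
by move=> i ilt; rewrite nth_mkseq// wu.
Qed.

Lemma adapted_integrable n F : adapted n F -> mu.-integrable setT (EFin \o F).
Proof.
move=> /adapted_sum ->.
rewrite (_ : EFin \o _ = fun w => (\sum_(u : n.-tuple X)
    (F (ext u))%:E * (\1_(cylinder n (ext u)) w)%:E)%E); last first.
  by apply/funext => w /=; rewrite -sumEFin.
apply: integrable_sum => // u _; apply: integrableZl => //.
by apply: integrable_indic => //; exact: measurable_cylinder.
Qed.

Lemma adapted_measurable n F : adapted n F ->
  @measurable_fun _ _ (trajType X) (\bar R) setT (fun w => (F w)%:E).
Proof. by move/adapted_integrable/measurable_int. Qed.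

Definition expec F : R := (\int[mu]_w F w)%R.

Lemma expecE n F : adapted n F -> (\int[mu]_w (F w)%:E = (expec F)%:E)%E.
Proof. by move=> /adapted_integrable iF; rewrite fineK//; exact: integrable_fin_num. Qed.

Lemma expecD n F G : adapted n F -> adapted n G ->
  expec (fun w => F w + G w) = expec F + expec G.
Proof.
move=> aF aG; rewrite /expec RintegralD//.
- exact: (adapted_integrable aF).
- exact: (adapted_integrable aG).
Qed.

Lemma expecZ n c F : adapted n F -> expec (fun w => c * F w) = c * expec F.
Proof. by move=> aF; rewrite /expec RintegralZl//; exact: (adapted_integrable aF). Qed.

Lemma expec_cst c : expec (fun=> c) = c.
Proof. by rewrite /expec Rintegral_cst//= (probability_setT mu) mulr1. Qed.

Lemma expec_le n F G : adapted n F -> adapted n G -> (forall w, F w <= G w) ->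
  expec F <= expec G.
Proof.
move=> aF aG FG; apply: le_Rintegral => //.
- exact: (adapted_integrable aF).
- exact: (adapted_integrable aG).
Qed.

Lemma expec_sum I (r : seq I) n (F : I -> (nat -> X) -> R) :
  (forall i, adapted n (F i)) ->
  expec (fun w => \sum_(i <- r) F i w) = \sum_(i <- r) expec (F i).
Proof.
move=> aF; elim: r => [|i r IH].
  by rewrite big_nil -[RHS]expec_cst; congr expec; apply/funext => w; rewrite big_nil.
rewrite big_cons -IH -(@expecD n)//; first by congr expec; apply/funext => w; rewrite big_cons.
by move=> w w' ww'; apply: eq_bigr => j _; exact: aF.
Qed.

Lemma expec_cylinder n w : expec (\1_(cylinder n w)) = fine (mu (cylinder n w)).
Proof. by rewrite /expec /Rintegral integral_indic ?setIT//; exact: measurable_cylinder. Qed.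

Lemma adapted_cylinder n w : adapted n (\1_(cylinder n w) : (nat -> X) -> R).
Proof.
move=> v v' vv'; rewrite !indicE; congr (_%:R); congr nat_of_bool.
by apply/idP/idP => /set_mem H; apply/mem_set => i ilt; rewrite -H ?vv'.
Qed.

Variable K : seq X -> dist R X.
Hypothesis muE : forall n w,
  mu (cylinder n w) = (\prod_(t < n) K (mkseq w t) (w t))%:E.

(** This is conditioning on the first [n] coordinates, derived from the cylinder probabilities
    alone: [K] is the conditional law of the next coordinate, and [F] may use both the past and that
    coordinate. *)
Lemma expec_next n (F : (nat -> X) -> X -> R) : (forall x, adapted n (F^~ x)) ->
  expec (fun w => F w (w n)) =
  expec (fun w => \sum_x K (mkseq w n) x * F w x).
Proof.
move=> aF.
have aK x : adapted n (fun w => K (mkseq w n) x).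
  move=> w w' ww'; congr (K _ x); apply: (@eq_from_nth _ point); rewrite ?size_mkseq//.
  by move=> i ilt; rewrite !nth_mkseq// ww'.
have aKF x : adapted n (fun w => K (mkseq w n) x * F w x).
  by move=> w w' ww'; rewrite (aK x _ _ ww') (aF x _ _ ww').
rewrite (@expec_sum _ _ n)//.
have -> : (fun w => F w (w n)) = fun w => \sum_x F w x * (w n == x)%:R.
  apply/funext => w; rewrite (bigD1 (w n))//= eqxx mulr1 big1 ?addr0//.
  by move=> y; rewrite eq_sym => /negbTE ->; rewrite mulr0.
have aS x (G : (nat -> X) -> R) : adapted n G ->
    adapted n.+1 (fun w => G w * (w n == x)%:R).
  by move=> aG w w' ww'; rewrite ww'// (aG w w')// => i ilt; apply: ww'; exact: ltnW.
rewrite (@expec_sum _ _ n.+1); last by move=> x; exact: aS.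
apply: eq_bigr => x _.
(* After summing over the value [x] of the next coordinate, only a function of the past times the
   indicator of [w n == x] remains; by linearity that function may be taken to be the indicator of a
   cylinder. *)
suff key (G : (nat -> X) -> R) : adapted n G ->
    expec (fun w => G w * (w n == x)%:R) = expec (fun w => K (mkseq w n) x * G w).
  exact: (key (F^~ x)).
move=> {F aF aKF} aG.
have sumE := adapted_sum aG.
transitivity (\sum_(u : n.-tuple X) G (ext u) *
    expec (fun w => \1_(cylinder n (ext u)) w * (w n == x)%:R)).
  rewrite [in LHS]sumE.
  under [X in expec X]eq_fun do rewrite big_distrl/=.
  rewrite (@expec_sum _ _ n.+1).
    apply: eq_bigr => u _; rewrite -(@expecZ n.+1); last exact/aS/adapted_cylinder.
    by congr expec; apply/funext => w; rewrite mulrA.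
  by move=> u; apply: aS => w w' ww'; rewrite (adapted_cylinder _ ww').
transitivity (\sum_(u : n.-tuple X) G (ext u) *
    expec (fun w => K (mkseq (ext u) n) x * \1_(cylinder n (ext u)) w)); last first.
  rewrite [in RHS]sumE.
  under [X in _ = expec X]eq_fun do rewrite big_distrr/=.
  rewrite (@expec_sum _ _ n).
    apply: eq_bigr => u _; rewrite -(@expecZ n); last first.
      by move=> w w' ww'; rewrite (adapted_cylinder _ ww').
    congr expec; apply/funext => w; rewrite !indicE.
    case: (boolP (w \in _)) => [/set_mem wu|_]; last by rewrite !mulr0.
    by rewrite !mulr1 mulrC; congr (_ * _); apply: aK => i ilt; rewrite wu.
  move=> u w w' ww'; rewrite (aK x _ _ ww'); congr (_ * (_ * _)).
  exact: adapted_cylinder.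
apply: eq_bigr => u _; congr (_ * _).
rewrite (@expecZ n); last exact: adapted_cylinder.
(* The word [u] followed by [x]: the product of the two indicators is the indicator of a cylinder of
   length [n.+1]. *)
pose v i := if (i < n)%N then ext u i else x.
have -> : (fun w => \1_(cylinder n (ext u)) w * (w n == x)%:R) =
          \1_(cylinder n.+1 v) :> (_ -> R).
  apply/funext => w; rewrite !indicE -natrM mulnb; congr (nat_of_bool _)%:R.
  apply/andP/idP => [[/set_mem wu /eqP wx]|/set_mem wv]; first apply/mem_set => i.
    by rewrite ltnS leq_eqVlt /v => /orP[/eqP->|ilt]; rewrite ?ltnn// ilt wu.
  split; last by rewrite wv// /v ltnn.
  by apply/mem_set => i ilt; rewrite wv ?/v ?ilt// ltnW.
have mE m : (m <= n)%N -> mkseq v m = mkseq (ext u) m.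
  move=> mn; apply: (@eq_from_nth _ point); rewrite ?size_mkseq// => i ilt.
  by rewrite !nth_mkseq// /v (leq_trans ilt mn).
rewrite !expec_cylinder !muE/= big_ord_recr/= mulrC mE// [v n]/v ltnn; congr (_ * _).
by apply: eq_bigr => i _; rewrite mE 1?ltnW// [v i]/v ltn_ord.
Qed.

End adapted_expectation.

(** * Expectation of upper limits *)

Lemma le_limn_esup (R : realType) (u v : (\bar R)^nat) :
  (forall n, (u n <= v n)%E) -> (limn_esup u <= limn_esup v)%E.
Proof.
move=> uv; rewrite !limn_esup_lim; apply: lee_lim; try exact: is_cvg_esups.
apply: nearW => n; apply: ge_ereal_sup => _ [k nk <-].
by apply: (le_trans (uv k)); apply: ereal_sup_ubound; exists k.
Qed.

Lemma le_limn_einf (R : realType) (u v : (\bar R)^nat) :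
  (forall n, (u n <= v n)%E) -> (limn_einf u <= limn_einf v)%E.
Proof. by move=> uv; rewrite leeN2; apply: le_limn_esup => n; rewrite leeN2. Qed.

Lemma limn_esup_cst (R : realType) (l : \bar R) : limn_esup (fun=> l) = l.
Proof. by apply: (cvg_limn_einf_sup _).2; exact: cvg_cst. Qed.

Section limit_expectation.
Variables (R : realType) (X : pointedFinType) (mu : probability (trajType X) R).
Variables (a : nat -> nat) (f : nat -> (nat -> X) -> R).
Hypothesis af : forall n, adapted (a n) (f n).

Let mf n : @measurable_fun _ _ (trajType X) (\bar R) setT (fun w => (f n w)%:E).
Proof. exact: (adapted_measurable mu (@af n)). Qed.

(** By monotone convergence the series of the [f n] has expectation at most [C], so it is finite
    almost everywhere and its terms tend to 0. *)
Lemma ae_cvg0 (C : R) : (forall n w, 0 <= f n w) ->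
  (forall N, \sum_(n < N) expec mu (f n) <= C) ->
  {ae mu, forall w : trajType X, (fun n => f n w) @ \oo --> 0}.
Proof.
move=> f0 fC; pose S (w : trajType X) := (\sum_(n <oo) (f n w)%:E)%E.
have mS : measurable_fun setT S by apply: ge0_emeasurable_sum => // n w _; rewrite lee_fin.
have S0 w : (0 <= S w)%E by apply: nneseries_ge0 => n _ _; rewrite lee_fin.
have iS : mu.-integrable setT S.
  apply/integrableP; split=> //; under eq_integral do rewrite gee0_abs//.
  rewrite integral_nneseries//; last by move=> n w _; rewrite lee_fin.
  apply: (@le_lt_trans _ _ C%:E); last exact: ltry.
  apply: lime_le.
    by apply: is_cvg_nneseries => n _ _; apply: integral_ge0 => w _; rewrite lee_fin.
  apply: nearW => N; rewrite big_mkord.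
  by under eq_bigr do rewrite (expecE mu (@af _)); rewrite sumEFin lee_fin.
move: (integrable_ae measurableT iS); apply: filterS => w /(_ I) Sfin.
apply: cvg_series_cvg_0; apply: nondecreasing_is_cvgn.
  by apply/nondecreasing_seqP => n; rewrite /series/= big_nat_recr//= lerDl.
exists (fine (S w)) => _ [N _ <-]; rewrite -lee_fin fineK// /series/= -sumEFin.
by apply: nneseries_lim_ge => n _ _; rewrite lee_fin.
Qed.

Let mlimsup : @measurable_fun _ _ (trajType X) (\bar R) setT
  (fun w => limn_esup (fun n => (f n w)%:E)).
Proof. exact: measurable_fun_limn_esup. Qed.

Let limsup_ge0 : (forall n w, 0 <= f n w) ->
  forall w, (0 <= limn_esup (fun n => (f n w)%:E))%E.
Proof. by move=> f0 w; rewrite -[leLHS]limn_esup_cst; apply: le_limn_esup => n; rewrite lee_fin. Qed.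

(** Fatou's lemma is applied to [g]. In the applications [f] is the average reward, and [g] is a
    potential of the current state or a constant, whose expectation is easy to bound. *)
Lemma integral_limsup_le (b : nat -> nat) (g : nat -> (nat -> X) -> R) (v : R) :
  (forall n w, 0 <= f n w) ->
  (forall n, adapted (b n) (g n)) -> (forall n w, 0 <= g n w) ->
  (forall n, expec mu (g n) <= v) ->
  {ae mu, forall w : trajType X,
     (limn_esup (fun n => (f n w)%:E) <= limn_einf (fun n => (g n w)%:E))%E} ->
  (\int[mu]_w limn_esup (fun n => (f n w)%:E) <= v%:E)%E.
Proof.
move=> f0 ag g0 gv fg.
have mg n : @measurable_fun _ _ (trajType X) (\bar R) setT (fun w => (g n w)%:E).
  exact: (adapted_measurable mu (ag n)).
apply: (@le_trans _ _ (\int[mu]_w limn_einf (fun n => (g n w)%:E))%E).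
  apply: ae_ge0_le_integral => //.
  - by move=> w _; exact: limsup_ge0.
  - move=> w _; rewrite /limn_einf leeNr oppe0 -[leRHS]limn_esup_cst.
    by apply: le_limn_esup => n; rewrite leeNl oppe0 lee_fin.
  - apply: measurableT_comp => //; apply: measurable_fun_limn_esup => n.
    exact: measurableT_comp.
  - by apply: filterS fg.
apply: (le_trans (@fatou _ (trajType X) R mu setT measurableT
  (fun n w => (g n w)%:E) mg _)); first by move=> n w _; rewrite lee_fin.
rewrite (_ : v%:E = limn_einf (fun=> v%:E)); last first.
  by rewrite /limn_einf limn_esup_cst oppeK.
by apply: le_limn_einf => n; rewrite (expecE mu (ag n)) lee_fin.
Qed.

(** Reverse Fatou, obtained from Fatou's lemma for [1 - f n]. The error [C / n.+1%:R] is what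
    remains when a bounded term is averaged over [n.+1] periods. *)
Lemma integral_limsup_ge (v C : R) :
  (forall n w, 0 <= f n w <= 1) ->
  (forall n, v - C / n.+1%:R <= expec mu (f n)) ->
  (v%:E <= \int[mu]_w limn_esup (fun n => (f n w)%:E))%E.
Proof.
move=> f01 vf; pose L (w : trajType X) := limn_esup (fun n => (f n w)%:E).
have f0 n w : 0 <= f n w by case/andP: (f01 n w).
have f1 n w : 0 <= 1 - f n w by rewrite subr_ge0; case/andP: (f01 n w).
have L0 w : (0 <= L w)%E by exact: limsup_ge0.
have L1 w : (L w <= 1)%E.
  by rewrite -[leRHS]limn_esup_cst; apply: le_limn_esup => n; rewrite lee_fin -subr_ge0.
have Lfin w : L w \is a fin_num.
  by rewrite fin_numElt (lt_le_trans _ (L0 w))//= (le_lt_trans (L1 w))// ltry.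
have LE w : (1 - L w)%E = limn_einf (fun n => (1 - f n w)%:E).
  under eq_fun do rewrite EFinB.
  rewrite (@limn_einf_shift _ (fun n => - (f n w)%:E)%E 1%E)//; congr (_ + _)%E.
  by rewrite -limn_einfN.
have a1f n : adapted (a n) (fun w => 1 - f n w) by move=> w w' ww'; rewrite (af ww').
have key : (\int[mu]_w (1 - L w) <= (1 - v)%:E)%E.
  under eq_integral do rewrite LE.
  apply: (le_trans (@fatou _ (trajType X) R mu setT measurableT
    (fun n w => (1 - f n w)%:E) _ _)).
  - by move=> n; exact: (adapted_measurable mu (a1f n)).
  - by move=> n w _; rewrite lee_fin.
  apply: (@le_trans _ _ (limn_einf (fun n => (1 - v + C / n.+1%:R)%:E))).
    apply: le_limn_einf => n; rewrite (expecE mu (a1f n)) lee_fin.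
    have -> : expec mu (fun w => 1 - f n w) = 1 - expec mu (f n).
      transitivity (expec mu (fun=> 1) + expec mu (fun w => -1 * f n w)).
        rewrite -(@expecD _ _ _ (a n))//; last by move=> w w' ww'; rewrite (af ww').
        by congr expec; apply/funext => w; rewrite mulN1r.
      by rewrite expec_cst (expecZ mu _ (@af n)) mulN1r.
    by rewrite -addrA lerD2l -[leRHS]opprK lerN2 opprD opprK; exact: vf.
  rewrite (_ : (1 - v)%:E = limn_einf (fun n => (1 - v + C / n.+1%:R)%:E))//.
  apply/esym; apply: (cvg_limn_einf_sup _).1; apply: cvg_EFin; first exact: nearW.
  rewrite /comp/= -[X in _ --> X]addr0; apply: cvgD; first exact: cvg_cst.
  rewrite -[X in _ --> X](mulr0 C); apply: cvgM; first exact: cvg_cst.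
  exact: cvg_harmonic.
have sumE : (\int[mu]_w (1 - L w) + \int[mu]_w L w = 1)%E.
  rewrite -ge0_integralD//=; first last.
  - exact: (emeasurable_funB (measurable_cst _) mlimsup).
  - by move=> w _; rewrite sube_ge0 ?L1 ?Lfin.
  rewrite -[RHS](probability_setT mu) -[RHS]mul1e -integral_cst//.
  by apply: eq_integral => w _; rewrite subeK.
(* Adding [1 - v] on both sides leaves a comparison with [sumE], with no subtraction of extended
   reals. *)
rewrite -/L -(@leeD2lE _ (1 - v)%:E)//.
rewrite -EFinD subrK -[leLHS]sumE; exact: leeD2r.
Qed.

End limit_expectation.

(** * Average return of a policy *)

Definition mean_step (R : realType) (S A : pointedFinType) (d : dist R A)
    (q : A -> dist R S) (G : A -> S -> R) : R :=
  \sum_a d a * \sum_s q a s * G a s.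

Section mean_step.
Variables (R : realType) (S A : pointedFinType) (d : dist R A) (q : A -> dist R S).
Implicit Types G H : A -> S -> R.

Lemma mean_step_cst (c : R) : mean_step d q (fun _ _ => c) = c.
Proof.
rewrite /mean_step; under eq_bigr do rewrite -big_distrl/= pmf_sum1 mul1r.
by rewrite -big_distrl/= pmf_sum1 mul1r.
Qed.

Lemma mean_step_le G H : (forall a s, G a s <= H a s) ->
  mean_step d q G <= mean_step d q H.
Proof.
move=> GH; apply: ler_sum => a _; apply: ler_wpM2l; first exact: Defs.pmf_ge0.
by apply: ler_sum => s _; rewrite ler_wpM2l ?Defs.pmf_ge0 ?GH.
Qed.

Lemma mean_stepD G H :
  mean_step d q (fun a s => G a s + H a s) = mean_step d q G + mean_step d q H.
Proof.
rewrite /mean_step -big_split/=; apply: eq_bigr => a _.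
by rewrite -mulrDr -big_split/=; congr (_ * _); apply: eq_bigr => s _; rewrite mulrDr.
Qed.

End mean_step.

Section mdp.
Variables (R : realType) (S A : pointedFinType) (M : rmdp R S A).
Variables (pi : policy R S A) (P : transition R S A).
Let X := (S * A)%type.
Let mu := traj_law M pi P.
Local Notation E := (expec mu).

Lemma next_state_mkseq n (w : nat -> X) :
  next_state M P (mkseq w n.+1) = P (w n).1 (w n).2.
Proof. by rewrite mkseqS; case: (mkseq w n) => //= y h; rewrite last_rcons. Qed.

Let muE n (w : nat -> X) :
  mu (cylinder n w) = (\prod_(t < n) step M pi P (mkseq w t) (w t))%:E.
Proof. exact: traj_lawE. Qed.

Let step_sum (h : seq X) (F : S -> R) :
  \sum_x step M pi P h x * F x.1 = \sum_s next_state M P h s * F s.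
Proof.
rewrite -(pair_bigA _ (fun s a => next_state M P h s * pi h s a * F s))/=.
apply: eq_bigr => s _; rewrite -big_distrl/= -big_distrr/= pmf_sum1.
by rewrite mulr1.
Qed.

Lemma expec_init (F : S -> R) : E (fun w => F (w 0%N).1) = \sum_s init M s * F s.
Proof.
rewrite (expec_next muE (F := fun=> fun x => F x.1))// -[RHS](expec_cst mu).
by congr expec; apply/funext => w; rewrite step_sum.
Qed.

(** A step draws the next state and then its action; summing out that action leaves the transition
    kernel. The past here includes the action taken at time [n]. *)
Lemma expec_state n (F : (nat -> X) -> S -> R) : (forall s, adapted n.+1 (F^~ s)) ->
  E (fun w => F w (w n.+1).1) = E (fun w => \sum_s P (w n).1 (w n).2 s * F w s).
Proof.
move=> aF; rewrite (expec_next muE (F := fun w x => F w x.1))//.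
by congr expec; apply/funext => w; rewrite step_sum next_state_mkseq.
Qed.

Lemma expec_action n (F : S -> A -> R) :
  E (fun w => F (w n).1 (w n).2) =
  E (fun w => \sum_a pi (mkseq w n) (w n).1 a * F (w n).1 a).
Proof.
have aK w w' : (forall i, (i < n)%N -> w i = w' i) -> mkseq w n = mkseq w' n :> seq X.
  move=> ww'; apply: (@eq_from_nth _ point); rewrite ?size_mkseq// => i ilt.
  by rewrite !nth_mkseq// ww'.
rewrite (expec_next muE (F := fun w x => F x.1 x.2))//.
rewrite (expec_next muE (F := fun w x => \sum_a pi (mkseq w n) x.1 a * F x.1 a)); last first.
  by move=> x w w' /aK ->.
congr expec; apply/funext => w.
rewrite (step_sum _ (fun s => \sum_a pi (mkseq w n) s a * F s a)).
rewrite -(pair_bigA _ (fun s a => step M pi P (mkseq w n) (s, a) * F s a))/=.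
apply: eq_bigr => s _; rewrite big_distrr; apply: eq_bigr => a _ /=.
by rewrite /step_pmf/= mulrA.
Qed.

Lemma expec_step n (G : S -> A -> S -> R) :
  E (fun w => G (w n).1 (w n).2 (w n.+1).1) =
  E (fun w => mean_step (pi (mkseq w n) (w n).1) (P (w n).1) (G (w n).1)).
Proof.
rewrite (expec_state (F := fun w s => G (w n).1 (w n).2 s)); last first.
  by move=> s w w' ->.
by rewrite (expec_action n (fun s a => \sum_s' P s a s' * G s a s')).
Qed.

Lemma adapted_state n (F : S -> R) : adapted n.+1 (fun w : nat -> X => F (w n).1).
Proof. by move=> w w' ->. Qed.

(** The last reward in the average is that of the transition from time [n] to [n.+1], hence the
    shift by two. *)
Lemma adapted_avg_reward n : adapted n.+2 (avg_reward M n).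
Proof.
move=> w w' ww'; rewrite /avg_reward; congr (_ / _); apply: eq_bigr => t _.
by rewrite !ww'// ltnS// ltnW.
Qed.

Hypothesis reward01 : forall s a s', 0 <= reward M s a s' <= 1.

Lemma avg_reward01 n w : 0 <= avg_reward M n w <= 1.
Proof.
rewrite /avg_reward divr_ge0//=; last first.
  by apply: sumr_ge0 => t _; case/andP: (reward01 (w t).1 (w t).2 (w t.+1).1).
rewrite ler_pdivrMr// mul1r -[leRHS]/(n.+1%:R) -[in leRHS](card_ord n.+1).
rewrite -sumr_const; apply: ler_sum => t _.
by case/andP: (reward01 (w t).1 (w t).2 (w t.+1).1).
Qed.

Lemma avg_return_ge0 : (0 <= avg_return M pi P)%E.
Proof.
have := @integral_limsup_ge _ _ mu _ _ adapted_avg_reward 0 0 avg_reward01; apply=> n.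
rewrite mul0r subr0 -[leLHS](expec_cst mu).
apply: (expec_le mu (n := n.+2)) => //; first exact: adapted_avg_reward.
by move=> w; case/andP: (avg_reward01 n w).
Qed.

Lemma avg_return_le1 : (avg_return M pi P <= 1)%E.
Proof.
apply: (@integral_limsup_le _ _ mu _ _ adapted_avg_reward (fun=> 0%N) (fun=> fun=> 1)) => //.
- by move=> n w; case/andP: (avg_reward01 n w).
- by move=> n; rewrite expec_cst.
- apply: nearW => w; rewrite /limn_einf limn_esup_cst oppeK -[leRHS]limn_esup_cst.
  by apply: le_limn_esup => n; rewrite lee_fin; case/andP: (avg_reward01 n w).
Qed.

Variable f : nat -> S -> dist R A.
Hypothesis pif : forall h s, pi h s = f (size h) s.

(** For a Markovian policy the one-step mean depends only on the time and the current state, so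
    inequalities between expectations can be checked state by state. *)
Let expec_stepf n (G : S -> A -> S -> R) :
  E (fun w => G (w n).1 (w n).2 (w n.+1).1) =
  E (fun w => mean_step (f n (w n).1) (P (w n).1) (G (w n).1)).
Proof. by rewrite expec_step; congr expec; apply/funext => w; rewrite pif size_mkseq. Qed.

Let expec_step_le n (F : S -> R) (G : S -> A -> S -> R) :
  (forall s, mean_step (f n s) (P s) (G s) <= F s) ->
  E (fun w => G (w n).1 (w n).2 (w n.+1).1) <= E (fun w => F (w n).1).
Proof.
move=> GF; rewrite expec_stepf; apply: (expec_le mu (n := n.+1)) => [||w]//.
- by move=> w w' ->.
- exact: adapted_state.
Qed.

Let expec_step_ge n (F : S -> R) (G : S -> A -> S -> R) :
  (forall s, F s <= mean_step (f n s) (P s) (G s)) ->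
  E (fun w => F (w n).1) <= E (fun w => G (w n).1 (w n).2 (w n.+1).1).
Proof.
move=> GF; rewrite expec_stepf; apply: (expec_le mu (n := n.+1)) => [||w]//.
- exact: adapted_state.
- by move=> w w' ->.
Qed.

Let adapted_step n (G : S -> A -> S -> R) :
  adapted n.+2 (fun w : nat -> X => G (w n).1 (w n).2 (w n.+1).1).
Proof. by move=> w w' ww'; rewrite !ww'. Qed.

(* Average-reward optimality inequalities with gain [V] and bias [h]; both may
   depend on time, as the policy does. *)
Lemma avg_return_ge (V h : nat -> S -> R) (C : R) :
  (forall n s, `|h n s| <= C) ->
  (forall n s, V n s <= mean_step (f n s) (P s) (fun _ s' => V n.+1 s')) ->
  (forall n s, V n s + h n s <=
     mean_step (f n s) (P s) (fun a s' => reward M s a s' + h n.+1 s')) ->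
  ((\sum_s init M s * V 0%N s)%:E <= avg_return M pi P)%E.
Proof.
move=> hC VP hP; rewrite -expec_init.
have EV n : E (fun w => V 0%N (w 0%N).1) <= E (fun w => V n (w n).1).
  by elim: n => // n /le_trans; apply; exact: (expec_step_ge (VP n)).
have Eh n : - C <= E (fun w => h n (w n).1) <= C.
  by apply/andP; split; [rewrite -[leLHS](expec_cst mu)|rewrite -[leRHS](expec_cst mu)];
    apply: (expec_le mu (n := n.+1)); do ?exact: adapted_state;
    do ?exact: (adaptedW (m := 0)) => //;
    move=> w; have := hC n (w n).1; rewrite ler_norml => /andP[].
have Er n : E (fun w => V n (w n).1) + E (fun w => h n (w n).1) <=
    E (fun w => reward M (w n).1 (w n).2 (w n.+1).1) + E (fun w => h n.+1 (w n.+1).1).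
  rewrite -(expecD mu (n := n.+1)); do ?exact: adapted_state.
  rewrite -(expecD mu (n := n.+2)); [|exact: adapted_step|exact: adapted_state].
  exact: (expec_step_ge (hP n)).
(* The biases telescope when the inequalities [Er] are summed. The first and the last survive, each
   at most [C] in absolute value, hence the error [C *+ 2]. *)
apply: (@integral_limsup_ge _ _ mu _ _ adapted_avg_reward _ (C *+ 2) avg_reward01) => n.
set r := fun t w => reward M (w t).1 (w t).2 (w t.+1).1.
have -> : E (avg_reward M n) = (\sum_(t < n.+1) E (r t)) / n.+1%:R.
  rewrite -(expec_sum mu (n := n.+2) _ (F := fun t : 'I_n.+1 => r t)); last first.
    by move=> t; apply: (@adaptedW _ _ t.+2 _ _ _ (adapted_step (n := t) _)); rewrite ltnS.
  rewrite mulrC -(expecZ mu (n := n.+2)); last first.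
    move=> w w' ww'; apply: eq_bigr => t _.
    by apply: (@adaptedW _ _ t.+2 _ _ _ (adapted_step (n := t) _)) ww'; rewrite ltnS.
  by congr expec; apply/funext => w; rewrite mulrC.
rewrite ler_pdivlMr// mulrBl divfK ?pnatr_eq0//.
suff tele m : m%:R * E (fun w => V 0%N (w 0%N).1) + E (fun w => h 0%N (w 0%N).1) <=
    \sum_(t < m) E (r t) + E (fun w => h m (w m).1).
  have /andP[h0 _] := Eh 0%N; have /andP[_ hm] := Eh n.+1; have := tele n.+1.
  rewrite mulr2n mulrC; lra.
elim: m => [|m IH]; first by rewrite mul0r big_ord0.
rewrite big_ord_recr/= -natr1 mulrDl mul1r.
have := Er m; have := EV m; rewrite -/(r m); lra.
Qed.

(* [U] controls the states that the policy never reaches, where no decrease of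
   the potential [W] is available. *)
Lemma avg_return_absorbed (z : S) (U W : S -> R) :
  (forall a, reward M z a z = 0) ->
  (forall s, 0 <= W s) ->
  \sum_s init M s * U s = 0 ->
  (forall n s, mean_step (f n s) (P s) (fun _ => U) <= U s) ->
  (forall n s, (s != z)%:R + mean_step (f n s) (P s) (fun _ => W) <= W s + U s) ->
  avg_return M pi P = 0%E.
Proof.
move=> rz W0 U0 PU PW; apply/eqP; rewrite eq_le avg_return_ge0 andbT.
have EU n : E (fun w => U (w n).1) <= 0.
  elim: n => [|n]; first by rewrite expec_init U0.
  by apply: le_trans; exact: (expec_step_le (PU n)).
have EW n : E (fun w => ((w n).1 != z)%:R) + E (fun w => W (w n.+1).1) <= E (fun w => W (w n).1).
  rewrite -(expecD mu (n := n.+2)); [|by move=> w w' ww'; rewrite ww'|exact: adapted_state].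
  apply: (@le_trans _ _ (E (fun w => W (w n).1 + U (w n).1))).
    apply: (@expec_step_le n (fun s => W s + U s) (fun s _ s' => (s != z)%:R + W s')) => s.
    by apply: le_trans (PW n s); rewrite mean_stepD mean_step_cst.
  by rewrite (expecD mu (n := n.+1)); [rewrite gerDl EU|exact: adapted_state..].
have EW0 n : 0 <= E (fun w => W (w n).1).
  rewrite -[leLHS](expec_cst mu); apply: (expec_le mu (n := n.+1)) => //; exact: adapted_state.
(* The potential pays for each period outside [z], so its initial mean bounds the expected number of
   such periods. *)
have sumz N : \sum_(n < N) E (fun w => ((w n).1 != z)%:R) <= E (fun w => W (w 0%N).1).
  suff: \sum_(n < N) E (fun w => ((w n).1 != z)%:R) + E (fun w => W (w N).1) <=
      E (fun w => W (w 0%N).1) by apply: le_trans; rewrite lerDl.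
  elim: N => [|N]; first by rewrite big_ord0 add0r.
  by apply: le_trans; rewrite big_ord_recr/= -addrA lerD2l.
have az n : adapted n.+1 (fun w : nat -> X => ((w n).1 != z)%:R : R).
  by move=> w w' ->.
have cvgz := ae_cvg0 (mu := mu) az (fun n w => ler0n _ _) sumz.
apply: (@integral_limsup_le _ _ mu _ _ adapted_avg_reward (fun=> 0%N) (fun=> fun=> 0)) => //.
- by move=> n w; case/andP: (avg_reward01 n w).
- by move=> n; rewrite expec_cst.
apply: filterS cvgz => w wz.
rewrite /limn_einf limn_esup_cst oppeK (cvg_limn_einf_sup (l := 0%E) _).2//.
apply: cvg_EFin; first exact: nearW.
rewrite (_ : _ \o _ = arithmetic_mean (fun n => reward M (w n).1 (w n).2 (w n.+1).1)).
  apply: cesaro; apply: cvg_near_cst.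
  (* A sequence of zeros and ones that tends to 0 is eventually 0: the path ends up in [z] forever,
     and the Cesaro means of its rewards tend to 0. *)
  have /cvgrPdist_lt/(_ 1 ltr01) := wz; move=> [N _ HN]; exists N => // n /= Nn.
  have zE m : (N <= m)%N -> (w m).1 = z.
    move=> Nm; apply/eqP; have := HN m Nm; rewrite /= sub0r normrN; case: eqP => //.
    by rewrite normr1 ltxx.
  by rewrite !zE ?rz// ltnW.
by apply/funext => n; rewrite /= /avg_reward /arithmetic_mean/series/= big_mkord mulrC.
Qed.

End mdp.

(** * Upper bound on the gadget *)

Lemma sum_state (V : nmodType) (F : state -> V) :
  \sum_s F s = F (live false) + F (live true) + (F (sink false) + F (sink true)).
Proof.
rewrite (reindex state_decode)/=; last first.
  by exists state_code => [[]|[]].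
by rewrite big_sumType/= !big_bool/= addrC (addrC (F (live true))) (addrC (F (sink true))) addrC.
Qed.

Lemma sum_action (V : nmodType) (F : action -> V) : \sum_a F a = F actT + F actB.
Proof.
rewrite (reindex action_decode)/=; last by exists action_code => [[]|[]].
by rewrite big_bool.
Qed.

Lemma sum_dirac (R : realType) (S : finType) (z : S) (F : S -> R) :
  \sum_s dist_dirac R z s * F s = F z.
Proof.
rewrite (bigD1 z)//= eqxx mul1r big1 ?addr0// => s.
by move=> /negbTE ->; rewrite mul0r.
Qed.

Section gadget.
Variables (R : realType) (x : live_sink_reward).
Implicit Types (p : bool -> R) (P : transition R state action).

Definition gadget_transition p P :=
  [/\ forall k, 0 <= p k <= 1,
      forall k a s', P (live k) a s' = live_pmf (p k) a s' &
      forall k a, P (sink k) a = dist_dirac R (sink k)].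

Lemma uncert_gadget P :
  uncert (gadget R x) P <-> exists p, gadget_transition p P.
Proof.
split=> [uP|[p [p01 PE PS]] [k|k]//]; last by exists (p k); split.
have [p0 [p001 p0E]] := uP (live false).
have [p1 [p101 p1E]] := uP (live true).
exists (fun k => if k then p1 else p0); split; try by case.
by move=> k a; exact: (uP (sink k)).
Qed.

Lemma live_pmf_ge0 (q : R) a s : 0 <= q <= 1 -> 0 <= live_pmf q a s.
Proof.
by case/andP => q0 q1; case: a; case: s => [[]|[]] //=; rewrite subr_ge0.
Qed.

Lemma live_pmf_sum1 (q : R) a : \sum_s live_pmf q a s = 1.
Proof. by rewrite sum_state; case: a => /=; ring. Qed.

Lemma gadget_transition_exists p : (forall k, 0 <= p k <= 1) ->
  exists P, gadget_transition p P.
Proof.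
move=> p01.
exists (fun s => match s with
  | live k => fun a => Dist (fun s => live_pmf_ge0 a s (p01 k)) (live_pmf_sum1 (p k) a)
  | sink k => fun=> dist_dirac R (sink k)
  end).
by split.
Qed.

Lemma gadget_reward01 s a s' : 0 <= reward (gadget R x) s a s' <= 1.
Proof.
by case: s => [i|[]]; case: s' => [[]|k] /=; rewrite ?lexx ?ler01//;
  case: (x i a k); rewrite ?lexx ?ler01.
Qed.

Section transition.
Variables (p : bool -> R) (P : transition R state action).
Hypothesis pP : gadget_transition p P.
Let p0 k : 0 <= p k. Proof. by case: pP => /(_ k)/andP[]. Qed.
Let p1 k : p k <= 1. Proof. by case: pP => /(_ k)/andP[]. Qed.

Lemma sum_liveT k F : \sum_s P (live k) actT s * F s =
  p k * F (sink false) + (1 - p k) * F (sink true).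
Proof. by case: pP => _ PE _; rewrite sum_state !PE/= !mul0r !add0r. Qed.

Lemma sum_liveB k F : \sum_s P (live k) actB s * F s =
  (1 - p k) * F (live false) + p k * F (live true).
Proof. by case: pP => _ PE _; rewrite sum_state !PE/= !mul0r !addr0. Qed.

Lemma sum_sink k a F : \sum_s P (sink k) a s * F s = F (sink k).
Proof. by case: pP => _ _ ->; exact: sum_dirac. Qed.

Lemma mean_live (d : dist R action) k G : mean_step d (P (live k)) G =
  d actT * (p k * G actT (sink false) + (1 - p k) * G actT (sink true)) +
  d actB * ((1 - p k) * G actB (live false) + p k * G actB (live true)).
Proof. by rewrite /mean_step sum_action sum_liveT sum_liveB. Qed.

Lemma mean_sink (d : dist R action) k G : mean_step d (P (sink k)) G =
  d actT * G actT (sink k) + d actB * G actB (sink k).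
Proof. by rewrite /mean_step sum_action !sum_sink. Qed.

(** * Martingale of the visits to [live true], and the upper bound for any policy *)

Variable pi : policy R state action.
Let X := (state * action)%type.
Let mu := traj_law (gadget R x) pi P.
Local Notation E := (expec mu).

(** Martingale increment: under B from [live k] the conditional probability of moving to [live true]
    is [p k]. It is 0 in all other cases, so it is centred whatever the policy does. *)
Definition excess (s : state) (a : action) (s' : state) : R :=
  match s, a with
  | live k, actB => (s' == live true)%:R - p k
  | _, _ => 0
  end.

Definition total_excess n (w : nat -> X) : R :=
  \sum_(t < n) excess (w t).1 (w t).2 (w t.+1).1.

Lemma adapted_total_excess n : adapted n.+1 (total_excess n).
Proof.
move=> w w' ww'; apply: eq_bigr => t _; rewrite !ww'// ltnS//.
exact: ltnW.
Qed.

Let sum_excess s a (F : R -> R) c :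
  (forall q, 0 <= q <= 1 -> (1 - q) * F (- q) + q * F (1 - q) <= c) ->
  \sum_s' P s a s' * F (excess s a s') <= c.
Proof.
move=> Fc.
(* The null increments are covered by the case [q = 0] of the hypothesis. *)
have F0 : F 0 <= c by have := Fc 0; rewrite subr0 mul1r oppr0 mul0r addr0 lexx ler01; apply.
case: s a => [k|k] [] /=; rewrite ?sum_sink// ?sum_liveT/=.
  by rewrite -mulrDl addrC subrK mul1r.
by rewrite sum_liveB/= sub0r; apply: Fc; rewrite p0 p1.
Qed.

Lemma total_excess2 n : E (fun w => total_excess n w ^+ 2) <= n%:R.
Proof.
elim: n => [|n IH].
  under [X in E X]eq_fun do rewrite /total_excess big_ord0 expr0n.
  by rewrite expec_cst.
under [X in E X]eq_fun do rewrite /total_excess big_ord_recr/= -/(total_excess n _).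
rewrite (@expec_state _ _ _ (gadget R x) pi P _
  (fun w s' => (total_excess n w + excess (w n).1 (w n).2 s') ^+ 2)); last first.
  by move=> s w w' ww'; rewrite (adapted_total_excess ww') !ww'.
apply: (@le_trans _ _ (E (fun w => total_excess n w ^+ 2 + 1))).
  apply: (expec_le mu (n := n.+1)) => [||w].
  - by move=> w w' ww'; rewrite (adapted_total_excess ww') !ww'.
  - by move=> w w' ww'; rewrite (adapted_total_excess ww').
  - apply: (@sum_excess _ _ (fun y => (total_excess n w + y) ^+ 2)) => q /andP[q0 q1].
    nra.
rewrite (expecD mu (n := n.+1))//; last by move=> w w' ww'; rewrite (adapted_total_excess ww').
by rewrite expec_cst -natr1 lerD2r.
Qed.

Lemma total_excess4 n : E (fun w => total_excess n w ^+ 4) <= 4 * n%:R ^+ 2.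
Proof.
elim: n => [|n IH].
  under [X in E X]eq_fun do rewrite /total_excess big_ord0 expr0n.
  by rewrite expec_cst expr0n mulr0.
under [X in E X]eq_fun do rewrite /total_excess big_ord_recr/= -/(total_excess n _).
rewrite (@expec_state _ _ _ (gadget R x) pi P _
  (fun w s' => (total_excess n w + excess (w n).1 (w n).2 s') ^+ 4)); last first.
  by move=> s w w' ww'; rewrite (adapted_total_excess ww') !ww'.
(* With the second moment bounded by [n], the increase is at most [8 * n + 3], which is below the
   increase [8 * n + 4] of [4 * n ^ 2]. *)
apply: (@le_trans _ _ (E (fun w => (total_excess n w ^+ 4 + 8 * total_excess n w ^+ 2) + 3))).
  apply: (expec_le mu (n := n.+1)) => [||w].
  - by move=> w w' ww'; rewrite (adapted_total_excess ww') !ww'.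
  - by move=> w w' ww'; rewrite (adapted_total_excess ww').
  - apply: (@sum_excess _ _ (fun y => (total_excess n w + y) ^+ 4)) => q /andP[q0 q1].
    move: (total_excess n w) => y.
    (* The central moments of order 2, 3 and 4 of a Bernoulli variable of parameter [q] are [v],
       [v * (1 - 2 * q)] and [v * (1 - 3 * v)]; the first-order term in the expansion vanishes. *)
    pose v := q * (1 - q).
    have v0 : 0 <= v by rewrite mulr_ge0 ?subr_ge0.
    have v1 : v <= 1 by rewrite /v; nra.
    have vq : v * (1 - 2 * q) <= 1 /\ - 1 <= v * (1 - 2 * q) by split; nra.
    have -> : (1 - q) * (y + - q) ^+ 4 + q * (y + (1 - q)) ^+ 4 =
      y ^+ 4 + 6 * v * y ^+ 2 + 4 * (v * (1 - 2 * q)) * y + v * (1 - 3 * v) by rewrite /v; ring.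
    move: (v * (1 - 2 * q)) vq => c [c1 cN1].
    have y2 : 0 <= y ^+ 2 by rewrite sqr_ge0.
    have cy : 4 * c * y <= 2 * y ^+ 2 + 2.
      have c2 : 0 <= (1 - c) * (1 + c) by rewrite mulr_ge0 ?subr_ge0// -lerBlDl sub0r.
      rewrite -subr_ge0 (_ : _ - _ = 2 * (y - c) ^+ 2 + 2 * ((1 - c) * (1 + c))); last by ring.
      by rewrite addr_ge0// mulr_ge0// sqr_ge0.
    have vy : v * y ^+ 2 <= y ^+ 2 by rewrite ler_piMl.
    have v3 : v * (1 - 3 * v) <= v by rewrite ler_piMr//; lra.
    lra.
rewrite (expecD mu (n := n.+1))//; last by move=> w w' ww'; rewrite (adapted_total_excess ww').
rewrite (expecD mu (n := n.+1)); try by move=> w w' ww'; rewrite (adapted_total_excess ww').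
rewrite (expecZ mu (n := n.+1)); try by move=> w w' ww'; rewrite (adapted_total_excess ww').
rewrite expec_cst [leRHS](_ : _ = 4 * n%:R ^+ 2 + 8 * n%:R + 4); last by rewrite -(natr1 n); ring.
apply: lerD; last by lra.
by apply: (lerD IH); rewrite ler_wpM2l ?total_excess2.
Qed.

(** The fourth power is used because it makes the expectations summable: they are at most
    [4 / m ^ 2] with [m = n + 1], whereas the bound on second moments only gives [1 / m]. *)
Lemma total_excess_cvg : {ae mu, forall w : trajType X,
  (fun n => total_excess n.+1 w / n.+1%:R) @ \oo --> 0}.
Proof.
pose G n w : R := (total_excess n.+1 w / n.+1%:R) ^+ 4.
have aG n : adapted n.+2 (G n).
  by move=> w w' ww'; rewrite /G (adapted_total_excess ww').
(* A telescoping majorant: [4 / m ^ 2 <= 8 / m - 8 / (m + 1)] for [m >= 1]. *)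
have EG N : \sum_(n < N) E (G n) <= 8 - 8 / N.+1%:R.
  elim: N => [|N IH]; first by rewrite big_ord0 divr1 subrr.
  rewrite big_ord_recr/=; have -> : E (G N) = N.+1%:R ^- 4 * E (fun w => total_excess N.+1 w ^+ 4).
    rewrite -(expecZ mu (n := N.+2)); last by move=> w w' ww'; rewrite (adapted_total_excess ww').
    by congr expec; apply/funext => w; rewrite /G expr_div_n mulrC.
  have N0 : 0 < N.+1%:R :> R by rewrite ltr0n.
  apply: (@le_trans _ _ (8 - 8 / N.+1%:R + N.+1%:R ^- 4 * (4 * N.+1%:R ^+ 2))).
    by rewrite lerD// ler_wpM2l ?total_excess4// invr_ge0 exprn_ge0// ltW.
  rewrite -(natr1 N.+1).
  move: (N.+1%:R : R) (ler1n R N.+1) N0 => m m1 m0.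
  have m1' : 0 < m + 1 by rewrite addr_gt0.
  rewrite -subr_ge0 (_ : _ - _ = 4 * (m - 1) / (m ^+ 2 * (m + 1))).
    by rewrite divr_ge0 ?mulr_ge0 ?exprn_ge0 ?subr_ge0// ltW.
  by field; rewrite !gt_eqF.
have := ae_cvg0 (mu := mu) (C := 8) aG.
have G0 n w : 0 <= G n w by rewrite exprn_even_ge0.
move=> /(_ G0); have EG8 N : \sum_(n < N) E (G n) <= 8.
  by apply: (le_trans (EG N)); rewrite gerBl divr_ge0.
move=> /(_ EG8); apply: filterS => w /cvgrPdist_lt Gw; apply/cvgrPdist_lt => e e0.
have := Gw (e ^+ 4) (exprn_gt0 _ e0); apply: filterS => n; rewrite !sub0r !normrN /G normrX.
by rewrite ltr_pXn2r// nnegrE// ltW.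
Qed.

(** Discarding the paths with a transition of probability zero allows the arguments that follow to
    be purely pathwise. *)
Lemma possible_transition : {ae mu, forall w : trajType X,
  forall n, P (w n).1 (w n).2 (w n.+1).1 != 0}.
Proof.
apply: ae_foralln => n.
pose G (w : nat -> X) : R := (P (w n).1 (w n).2 (w n.+1).1 == 0)%:R.
have aG : adapted n.+2 G by move=> w w' ww'; rewrite /G !ww'.
have EG : E G = 0.
  rewrite /G (@expec_state _ _ _ (gadget R x) pi P _
  (fun w s' => (P (w n).1 (w n).2 s' == 0)%:R)); last first.
    by move=> s w w' ->.
  rewrite -[RHS](expec_cst mu); congr expec; apply/funext => w.
  by apply: big1 => s _; have [->|] := eqVneq; rewrite ?mul0r ?mulr0.
(* On a constant sequence, convergence to 0 means that the constant is 0. *)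
have := ae_cvg0 (mu := mu) (C := 0) (f := fun=> G) (fun=> aG) (fun _ _ => ler0n _ _).
have EG0 N : \sum_(n0 < N) E G <= 0 by rewrite big1.
move=> /(_ EG0); apply: filterS => w /(cvg_lim (@Rhausdorff R)).
rewrite lim_cst; last exact: Rhausdorff.
by rewrite /G => /eqP; rewrite pnatr_eq0 eqb0.
Qed.

Lemma cvg_avg_reward_sink w n k : (forall m, P (w m).1 (w m).2 (w m.+1).1 != 0) ->
  (w n).1 = sink k ->
  (forall m, (n <= m)%N -> (w m).1 = sink k) /\
  (avg_reward (gadget R x))^~ w @ \oo --> (k%:R : R).
Proof.
move=> Pw wn; case: pP => _ _ PS.
have wm m : (n <= m)%N -> (w m).1 = sink k.
  elim: m => [|m IH]; first by rewrite leqn0 => /eqP <-.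
  rewrite leq_eqVlt => /predU1P[<-//|]; rewrite ltnS => /IH wm.
  by have := Pw m; rewrite wm PS/= pnatr_eq0 eqb0 negbK => /eqP.
split=> //; rewrite (_ : _^~ w = arithmetic_mean
    (fun t => reward (gadget R x) (w t).1 (w t).2 (w t.+1).1)).
  by apply: cesaro; apply: cvg_near_cst; exists n => // m /= nm; rewrite wm.
by apply/funext => m; rewrite /avg_reward /arithmetic_mean/series/= big_mkord mulrC.
Qed.

(** On a path without absorption only B is played, since T leads to a sink, and the rewards count
    the visits to [live true]. Their frequency follows from a balance equation and the law of large
    numbers for the excess. *)
Lemma cvg_avg_reward_live w : 0 < 1 + p false - p true ->
  (forall n, P (w n).1 (w n).2 (w n.+1).1 != 0) ->
  (forall n k, (w n).1 <> sink k) ->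
  (fun n => total_excess n.+1 w / n.+1%:R) @ \oo --> (0 : R) ->
  (avg_reward (gadget R x))^~ w @ \oo --> p false / (1 + p false - p true).
Proof.
set den := 1 + _ - _ => den0 Pw wlive excess0; case: pP => _ PE _.
pose o t : R := ((w t).1 == live true)%:R.
have wB n : (w n).2 = actB.
  have := wlive n.+1; have := wlive n; have := Pw n.
  case: (w n) => -[k|k] a /=; last by move=> _ /(_ k).
  by rewrite PE; case: a => //=; case: (w n.+1) => -[k'|k'] ? /=; rewrite ?eqxx// => _ _ /(_ k').
have wl n : (w n).1 = live ((w n).1 == live true).
  by have := wlive n; case: (w n) => -[[]|k] a //= /(_ k).
have rE t : reward (gadget R x) (w t).1 (w t).2 (w t.+1).1 = o t.+1.
  rewrite /o (wl t) (wl t.+1)/=; by case: (_ == _).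
(* Sum of the identities [o t.+1 = p false + (p true - p false) * o t + excess], where shifting the
   index of [o] costs a boundary term. *)
have NE n : den * \sum_(t < n) o t.+1 =
    n%:R * p false + total_excess n w + (p true - p false) * (o 0%N - o n).
  elim: n => [|n IH]; first by rewrite /total_excess !big_ord0; ring.
  rewrite /total_excess !big_ord_recr/= -/(total_excess n w) mulrDr IH -natr1.
  have -> : excess (w n).1 (w n).2 (w n.+1).1 = o n.+1 - (p false + (p true - p false) * o n).
    by rewrite wB {1}(wl n)/= /o; case: ((w n).1 == live true) => /=; ring.
  by rewrite /den; ring.
pose b n : R := o 0%N - o n.+1.
have avgE n : avg_reward (gadget R x) n w = p false / den +
    (den^-1 * (total_excess n.+1 w / n.+1%:R) + (p true - p false) / den * (b n / n.+1%:R)).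
  rewrite /avg_reward; under eq_bigr do rewrite rE.
  have -> : \sum_(t < n.+1) o t.+1 = den^-1 * (den * \sum_(t < n.+1) o t.+1).
    by rewrite mulrA mulVf ?mul1r// gt_eqF.
  have n0 : n.+1%:R != 0 :> R by rewrite pnatr_eq0.
  by rewrite NE /b; move: (n.+1%:R : R) n0 => m m0; field; rewrite m0 gt_eqF.
have b0 : (fun n => b n / n.+1%:R) @ \oo --> (0 : R).
  apply/cvgrPdist_lt => e e0.
  have := @cvg_harmonic R; move=> /cvgrPdist_lt/(_ e e0); apply: filterS => n.
  rewrite !sub0r !normrN normrM; apply: le_lt_trans.
  rewrite /harmonic/= -[leRHS]mul1r ler_wpM2r//.
  by rewrite /b /o; case: (_ == _) => /=; case: (_ == _) => /=;
    rewrite ?subrr ?subr0 ?sub0r ?normrN ?normr0 ?normr1.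
rewrite (funext avgE) -[p false / den in X in _ --> X]addr0; apply: cvgD; first exact: cvg_cst.
rewrite -[X in _ --> X]addr0; apply: cvgD.
  by rewrite -(mulr0 den^-1); apply: cvgM => //; exact: cvg_cst.
rewrite -[X in _ --> X](mulr0 ((p true - p false) / den)).
by apply: cvgM => //; exact: cvg_cst.
Qed.

Lemma avg_return_le (v : R) : 0 < 1 + p false - p true ->
  (forall k, 1 - p k <= v) -> p false / (1 + p false - p true) <= v ->
  (avg_return (gadget R x) pi P <= v%:E)%E.
Proof.
move=> den0 pv cv; pose V s : R := match s with live _ => v | sink k => k%:R end.
have v0 : 0 <= v by apply: le_trans (pv false); rewrite subr_ge0.
have V0 s : 0 <= V s by case: s => /=.
apply: (@integral_limsup_le _ _ mu _ _ (@adapted_avg_reward _ _ _ _)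
  S (fun n w => V (w n).1)).
- by move=> n w; case/andP: (avg_reward01 gadget_reward01 n w).
- by move=> n; exact: adapted_state.
- by move=> n w; exact: V0.
(* [V] is a supermartingale: B keeps the value [v] on live states, and T replaces it by [1 - p k],
   which is at most [v]. *)
- elim=> [|n]; first by rewrite expec_init sum_dirac.
  apply: le_trans; rewrite (@expec_state _ _ _ (gadget R x) pi P _ (fun _ s => V s))//.
  apply: (expec_le mu (n := n.+1)) => [||w].
  + by move=> w w' ->.
  + exact: adapted_state.
  + case: (w n) => -[k|k] [] /=; rewrite ?sum_sink// ?sum_liveT ?sum_liveB/=.
      by rewrite mulr0 add0r mulr1.
    by rewrite -mulrDl subrK mul1r.
move: total_excess_cvg possible_transition; apply: filterS2 => w wM wP.
(* After absorption in [sink k], the average reward and [V] both tend to [k]. Otherwise [V] stays at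
   [v], which dominates the limit of the average reward. *)
have [[n [k wn]]|wlive] := pselect (exists n k, (w n).1 = sink k).
  have [wk wavg] := cvg_avg_reward_sink wP wn.
  rewrite (cvg_limn_einf_sup (l := k%:R%:E) _).2; last first.
    by apply: cvg_EFin => //; exact: nearW.
  rewrite (cvg_limn_einf_sup (l := k%:R%:E) _).1//.
  apply: cvg_EFin; first exact: nearW.
  by apply: cvg_near_cst; exists n => // m /= nm; rewrite wk.
have {}wlive n k : (w n).1 <> sink k by move=> wn; apply: wlive; exists n, k.
rewrite (cvg_limn_einf_sup (l := (p false / (1 + p false - p true))%:E) _).2; last first.
  apply: cvg_EFin; first exact: nearW.
  exact: cvg_avg_reward_live.
rewrite (_ : (fun n => _) = (fun=> v%:E)) /limn_einf ?limn_esup_cst ?oppeK ?lee_fin//.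
by apply/funext => n; have := wlive n; case: (w n) => -[k|k] a //= /(_ k).
Qed.

End transition.
End gadget.

(** * Policies for the gadget *)

Section pmf_action.
Variables (R : realType) (d : dist R action).

Lemma pmf_actB : d actB = 1 - d actT.
Proof. by rewrite -(pmf_sum1 d) sum_action addrAC subrr add0r. Qed.

End pmf_action.

Section policies.
Variables (R : realType) (x : live_sink_reward).

Definition pure (a : bool -> action) (s : state) : dist R action :=
  dist_dirac R (if s is live k then a k else actB).

Definition stat (d : state -> dist R action) : policy R state action :=
  fun _ => d.

Let half01 (a : action) : 0 <= 2^-1 :> R. Proof. by rewrite invr_ge0. Qed.
Let half_sum1 : \sum_(a : action) 2^-1 = 1 :> R.
Proof. by rewrite sum_action; field. Qed.

Definition even_odds : dist R action := Dist half01 half_sum1.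

(* Why gamble at time 1 and not 0: driven by B, the chain is in [live true] at
   time 2 with probability at most its stationary one, whereas at time 1 this
   fails when [p true < p false]. *)
Definition gamble_once (n : nat) (s : state) : dist R action :=
  if n == 1%N then even_odds else dist_dirac R actB.

Definition gamble_policy : policy R state action := fun h s => gamble_once (size h) s.

(** * Guarantees of three pure stationary policies and of the gambling policy *)

Section lower_bounds.
Variables (p : bool -> R) (P : transition R state action).
Hypothesis pP : gadget_transition p P.
Let p0 k : 0 <= p k. Proof. by case: pP => /(_ k)/andP[]. Qed.
Let p1 k : p k <= 1. Proof. by case: pP => /(_ k)/andP[]. Qed.

Let lower pi f (V h : nat -> state -> R) (C : R) :
  (forall t s, pi t s = f (size t) s) ->
  (forall n s, `|h n s| <= C) ->
  (forall n s, V n s <= mean_step (f n s) (P s) (fun _ s' => V n.+1 s')) ->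
  (forall n s, V n s + h n s <= mean_step (f n s) (P s)
     (fun a s' => reward (gadget R x) s a s' + h n.+1 s')) ->
  ((V 0%N (live false))%:E <= avg_return (gadget R x) pi P)%E.
Proof.
move=> pif hC VP hP.
have := avg_return_ge (@gadget_reward01 R x) pif hC VP hP.
by rewrite sum_dirac.
Qed.

Lemma avg_return_TT :
  ((1 - p false)%:E <= avg_return (gadget R x) (stat (pure (fun=> actT))) P)%E.
Proof.
pose V s : R := match s with live k => 1 - p k | sink k => k%:R end.
(* The reward of the absorbing transition may be 0 while the gain is up to 1; the bias -1 makes up
   for it. *)
pose h s : R := if s is live _ then -1 else 0.
apply: (@lower _ (fun=> pure (fun=> actT)) (fun=> V) (fun=> h) 1) => // _ [k|k].
- by rewrite normrN1.
- by rewrite normr0.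
- by rewrite (mean_live pP) /= !mulr0 !mulr1 mul1r mul0r !add0r addr0.
- by rewrite (mean_sink pP) -mulrDl -sum_action pmf_sum1 mul1r.
- rewrite (mean_live pP) /= mul1r mul0r !addr0.
  have := ler0n R (x k actT false); have := ler0n R (x k actT true).
  have := p0 k; have := p1 k; nra.
- by rewrite (mean_sink pP) -mulrDl -sum_action pmf_sum1 mul1r.
Qed.

Lemma avg_return_BT : 0 < p false ->
  ((1 - p true)%:E <=
     avg_return (gadget R x) (stat (pure (fun k => if k then actT else actB))) P)%E.
Proof.
move=> pf; pose V s : R := match s with live k => 1 - p true | sink k => k%:R end.
(* The expected time to leave [live false] under B is [(p false)^-1], and the gain lost in each
   period is at most 1. *)
pose h s : R := match s with live k => if k then -1 else - (p false)^-1 | sink _ => 0 end.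
pose d := pure (fun k => if k then actT else actB).
apply: (@lower _ (fun=> d) (fun=> V) (fun=> h) (1 + (p false)^-1)) => // _ [[]|k].
- by rewrite normrN1 lerDl invr_ge0.
- by rewrite normrN ger0_norm ?invr_ge0// lerDr.
- by rewrite normr0 addr_ge0// invr_ge0.
- by rewrite (mean_live pP) /= !mulr0 !mulr1 mul1r mul0r !add0r addr0.
- by rewrite (mean_live pP) /= mul0r add0r mul1r -mulrDl subrK mul1r.
- by rewrite (mean_sink pP) -mulrDl -sum_action pmf_sum1 mul1r.
- rewrite (mean_live pP) /= mul1r mul0r !addr0.
  have := ler0n R (x true actT false); have := ler0n R (x true actT true).
  have := p0 true; have := p1 true; nra.
- rewrite (mean_live pP) /= mul0r mul1r !add0r subrr mulr0 addr0 mulrBl mul1r.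
  by rewrite mulrN divff ?gt_eqF// opprK addrC lerD2l gerBl.
- by rewrite (mean_sink pP) -mulrDl -sum_action pmf_sum1 mul1r.
Qed.

Let den := 1 + p false - p true.
(* If [den = 0] then [p false = 0] and the chain stays in [live false], so that
   the junk value [gain = 0] is the correct one. *)
Let gain := p false / den.
(** Value of [live true] relative to [live false] in the Poisson equation of the chain driven by
    B. *)
Let bias := (p true - p false) / den.

(** The two middle bounds are the Poisson equation, in a form that also covers [den = 0]. The last
    one bounds the probability of being in [live true] at time 2 under B, because
    [(1 + d) * (1 - d) <= 1] with [d = p true - p false]. *)
Let gainP : [/\ 0 <= gain <= 1, gain <= p false * (1 + bias),
  gain + bias <= p true * (1 + bias) & p false * (1 + p true - p false) <= gain].
Proof.
have := p0 false; have := p1 true; have := p0 true; have := p1 false.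
rewrite /gain /bias /den; have [den0|denN0] := eqVneq (1 + p false - p true) 0.
  rewrite den0 invr0 !mulr0 => *.
  have -> : p false = 0 by lra.
  by split; lra.
move=> pf1 pt0 pt1 pf0; have den0 : 0 < 1 + p false - p true.
  by rewrite lt_def denN0/=; lra.
have biasE : 1 + (p true - p false) / (1 + p false - p true) = (1 + p false - p true)^-1.
  by field.
split.
- apply/andP; split; first by rewrite divr_ge0// ltW.
  by rewrite ler_pdivrMr// mul1r; lra.
- by rewrite biasE.
- by rewrite biasE -mulrDl addrC subrK.
- rewrite ler_pdivlMr// -mulrA ler_piMr//.
  rewrite (_ : _ * _ = 1 - (p true - p false) ^+ 2); last by ring.
  by rewrite gerBl sqr_ge0.
Qed.

Lemma avg_return_BB :
  ((p false / (1 + p false - p true))%:E <=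
     avg_return (gadget R x) (stat (pure (fun=> actB))) P)%E.
Proof.
have [_ g0 g1 _] := gainP.
pose V s : R := match s with live k => gain | sink k => k%:R end.
pose h s : R := if s is live true then bias else 0.
apply: (@lower _ (fun=> pure (fun=> actB)) (fun=> V) (fun=> h) `|bias|) => // _ [k|k].
- by case: k; rewrite /= ?normr0.
- by rewrite /= normr0.
- by rewrite (mean_live pP) /= mul0r add0r mul1r -mulrDl subrK mul1r.
- by rewrite (mean_sink pP) -mulrDl -sum_action pmf_sum1 mul1r.
- rewrite (mean_live pP) /= mul0r add0r mul1r !addr0 mulr0 add0r.
  by case: k; rewrite /= ?addr0.
- by rewrite (mean_sink pP) -mulrDl -sum_action pmf_sum1 mul1r.
Qed.

Lemma avg_return_gamble : ((1 / 2)%:E <= avg_return (gadget R x) gamble_policy P)%E.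
Proof.
have [/andP[g0 g1] gf gt gm2] := gainP.
pose V2 s : R := match s with live k => gain | sink k => k%:R end.
pose V1 s : R := match s with live k => (1 - p k) / 2 + gain / 2 | sink k => k%:R end.
pose V0 s : R := match s with
  live k => (1 - p k) * V1 (live false) + p k * V1 (live true) | sink k => k%:R end.
pose V n := match n with 0 => V0 | 1 => V1 | _ => V2 end%N.
pose h2 s : R := if s is live true then bias else 0.
(* The bias rises by 1 at time 0 and by at least 1 at time 1. As [V] is at most 1 and rewards are
   nonnegative, the reward inequality holds at these times whatever is earned. *)
pose h n : state -> R := match n with
  0 => fun=> - (`|bias| + 2) | 1 => fun=> - (`|bias| + 1) | _ => h2 end%N.
have b0 := normr_ge0 bias.
have h2b s : - `|bias| <= h2 s <= `|bias|.
  by rewrite -ler_norml; case: s => [[]|k] //=; rewrite normr0.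
have V01 s : V0 s <= 1 /\ V1 s <= 1.
  have V1le k : V1 (live k) <= 1 by rewrite /=; have := p0 k; lra.
  case: s => [k|[]] //; split=> //.
  rewrite [leRHS](_ : _ = (1 - p k) * 1 + p k * 1); last by ring.
  by apply: lerD; apply: ler_wpM2l; rewrite ?subr_ge0.
have r0 s a s' : 0 <= reward (gadget R x) s a s' by case/andP: (@gadget_reward01 R x s a s').
(* Playing T at time 1 leads to [sink false] with the same probability as B would lead to
   [live true], namely [m_2 = p false * (1 + p true - p false)]. So the initial value is
   [(1 - m_2) / 2 + gain / 2], and [gain >= m_2] suffices. *)
apply: (@le_trans _ _ (V 0%N (live false))%:E).
  rewrite lee_fin /= -subr_ge0.
  rewrite (_ : _ - _ = (gain - p false * (1 + p true - p false)) / 2); last by field.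
  by rewrite divr_ge0 ?subr_ge0.
apply: (@lower _ gamble_once V h (`|bias| + 2)) => // [] [|[|n]] s.
- by rewrite normrN ger0_norm ?addr_ge0.
- by rewrite normrN ger0_norm ?addr_ge0// lerD2l; lra.
- by have := h2b s; rewrite -ler_norml => /le_trans; apply; rewrite lerDl.
- rewrite /gamble_once/=; case: s => k; last first.
    by rewrite (mean_sink pP) -mulrDl -sum_action pmf_sum1 mul1r.
  by rewrite (mean_live pP) /= mul0r add0r mul1r.
- rewrite /gamble_once/=; case: s => k; last first.
    by rewrite (mean_sink pP) -mulrDl -sum_action pmf_sum1 mul1r.
  rewrite (mean_live pP) /= mulr0 mulr1 add0r -[X in _ + _ * X]mulrDl subrK mul1r.
  by rewrite mulrC (mulrC _ gain).
- rewrite /gamble_once/=; case: s => k; last first.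
    by rewrite (mean_sink pP) -mulrDl -sum_action pmf_sum1 mul1r.
  by rewrite (mean_live pP) /= mul0r add0r mul1r -mulrDl subrK mul1r.
- apply: (@le_trans _ _ (- (`|bias| + 1))); first by have [] := V01 s; rewrite /=; lra.
  rewrite -[leLHS](mean_step_cst (gamble_once 0 s) (P s)); apply: mean_step_le => a s'.
  by rewrite lerDr.
- apply: (@le_trans _ _ (- `|bias|)); first by have [_] := V01 s; rewrite /=; lra.
  rewrite -[leLHS](mean_step_cst (gamble_once 1 s) (P s)); apply: mean_step_le => a s'.
  by have := r0 s a s'; have /andP[] := h2b s'; rewrite /=; lra.
- rewrite /gamble_once/=; case: s => k; last first.
    by rewrite (mean_sink pP) -mulrDl -sum_action pmf_sum1 mul1r.
  rewrite (mean_live pP) /= mul0r add0r mul1r !addr0 mulr0 add0r.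
  by case: k; rewrite /= ?addr0.
Qed.

End lower_bounds.

(** The adversary knows where T has positive probability: it freezes the chain in [live false] if T
    is never played there, and otherwise drives it to [sink false] in finite expected time. *)
Lemma avg_return_stat0 (d : state -> dist R action) :
  exists2 P, uncert (gadget R x) P & forall pi : policy R state action,
    (forall h s, pi h s = d s) -> avg_return (gadget R x) pi P = 0%E.
Proof.
set c := d (live false) actT; set e := d (live true) actT.
have c0 : 0 <= c by exact: Defs.pmf_ge0.
have e0 : 0 <= e by exact: Defs.pmf_ge0.
have dB k : d (live k) actB = 1 - (if k then e else c) by rewrite pmf_actB; case: k.
have sinkE P p (pP : gadget_transition p P) (F : state -> R) k :
    mean_step (d (sink k)) (P (sink k)) (fun=> F) = F (sink k).
  by rewrite (mean_sink pP) -mulrDl -sum_action pmf_sum1 mul1r.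
have [cE|cN0] := eqVneq c 0.
  have z01 (k : bool) : 0 <= (0 : R) <= 1 by rewrite lexx ler01.
  have [P pP] := @gadget_transition_exists R (fun=> 0) z01.
  exists P; first by apply/uncert_gadget; exists (fun=> 0).
  move=> pi piE.
  (* With [p = 0] the chain never leaves [live false], so all other states count as unreached. *)
  pose U (s : state) : R := (s != live false)%:R.
  apply: (@avg_return_absorbed _ _ _ (gadget R x) pi P (@gadget_reward01 R x) (fun=> d) piE
    (live false) U (fun=> 0)) => //.
  - by rewrite sum_dirac /U eqxx.
  - move=> _ s; have [->|sN] := eqVneq s (live false).
      by rewrite (mean_live pP) -/c cE /U/= !(mul0r, mulr0, addr0).
    rewrite {2}/U sN -[leRHS](mean_step_cst (d s) (P s)); apply: mean_step_le => a s'.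
    by rewrite /U lern1 leq_b1.
  - by move=> n s; rewrite mean_step_cst addr0 add0r.
pose p (k : bool) : R := if k then (e != 0)%:R else 1.
have p01 k : 0 <= p k <= 1.
  by case: k; rewrite /p ?ler01 ?lexx//; case: (_ == _); rewrite ?ler01 ?lexx.
have [P pP] := gadget_transition_exists p01.
exists P; first by apply/uncert_gadget; exists p.
move=> pi piE.
have c_gt0 : 0 < c by rewrite lt_def cN0.
pose K := c^-1 + e^-1.
(* Potential bounding the expected time to absorption. For [e = 0] it is the exact solution of
   [t0 = 1 + (1 - c) * t1] and [t1 = 1 + t0]; otherwise [K] is a convenient upper bound for both
   live states. *)
pose W (s : state) : R := match s with
  | live k => if e == 0 then if k then 2 / c else 2 / c - 1 else K
  | sink _ => 0 end.
pose U (s : state) : R := (s == sink true)%:R.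
have c1 : c <= 1 by rewrite -subr_ge0 -(dB false) Defs.pmf_ge0.
have c2 : 1 <= 2 / c by rewrite ler_pdivlMr//; lra.
apply: (@avg_return_absorbed _ _ _ (gadget R x) pi P (@gadget_reward01 R x) (fun=> d) piE
  (sink false) U W) => //.
- by case=> [k|k] //=; case: ifP => _; [case: k; lra|rewrite addr_ge0// invr_ge0].
- by rewrite sum_dirac.
- move=> _ [k|k]; last by rewrite (sinkE _ _ pP).
  rewrite (mean_live pP) /U/= !(mulr0, addr0, add0r, mulr1).
  case: k; rewrite /p ?subrr ?mulr0// -/e.
  by have [->|_] := eqVneq e 0; rewrite ?mul0r// subrr mulr0.
- move=> _ [k|[]]; rewrite ?(sinkE _ _ pP)/= ?addr0 ?add0r//.
  rewrite (mean_live pP) /U/= !(mulr0, addr0, add0r) dB.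
  have [eE|eN0] := eqVneq e 0.
    case: k; rewrite /p/=.
      by rewrite eE eqxx subr0 !mul1r mul0r addr0; lra.
    by rewrite subrr mul0r add0r mul1r mulrBl mul1r mulrCA divff// mulr1; lra.
  have e_gt0 : 0 < e by rewrite lt_def eN0.
  have ei : 0 <= e^-1 by rewrite invr_ge0.
  have e1 : e <= 1 by rewrite -subr_ge0 -(dB true) Defs.pmf_ge0.
  rewrite -mulrDl subrK mul1r mulrBl mul1r addrCA gerDl subr_le0.
  case: k; rewrite /K mulrDr ?[c * c^-1]divff// ?[e * e^-1]divff// ?lerDl ?lerDr;
    by rewrite divr_ge0.
Qed.

End policies.

(** * Optimal value for a fixed kernel, and its minimum over the adversary *)

Section gadget_value.
Variables (R : realType) (x : live_sink_reward).
Implicit Types (p : bool -> R) (P : transition R state action).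

Definition gadget_value p : R :=
  if p false == 0 then 1
  else Num.max (Num.max (1 - p false) (1 - p true)) (p false / (1 + p false - p true)).

(** Reads the adversary's scalars off the kernel, since [is_min_max] wants the inner maximum as a
    function of [P]. *)
Definition death_prob P (k : bool) : R := P (live k) actT (sink false).

Lemma death_probE p P : gadget_transition p P -> death_prob P = p.
Proof. by case=> _ PE _; apply/funext => k; rewrite /death_prob PE. Qed.

Lemma avg_return_le_value p P (pi : policy R state action) : gadget_transition p P ->
  (avg_return (gadget R x) pi P <= (gadget_value p)%:E)%E.
Proof.
(* [avg_return_le] requires a positive denominator, which [p false > 0] ensures; for [p false = 0]
   the rewards being at most 1 is enough. *)
move=> pP; rewrite /gadget_value; have [p0|pN0] := eqVneq.
  exact: avg_return_le1 (@gadget_reward01 R x).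
case: (pP) => p01 _ _; have /andP[pf0 pf1] := p01 false; have /andP[pt0 pt1] := p01 true.
have pf_gt0 : 0 < p false by rewrite lt_def pN0.
apply: (avg_return_le x pP) => [|k|]; first lra; last by rewrite le_max lexx orbT.
by rewrite !le_max; case: k; rewrite lexx ?orbT.
Qed.

Lemma gadget_value_attained p P : gadget_transition p P ->
  exists d : state -> dist R action,
    ((gadget_value p)%:E <= avg_return (gadget R x) (stat d) P)%E.
Proof.
move=> pP; rewrite /gadget_value; have [p0|pN0] := eqVneq.
  by exists (pure R (fun=> actT)); have := avg_return_TT x pP; rewrite p0 subr0.
case: (pP) => p01 _ _; have /andP[pf0 _] := p01 false.
have pf_gt0 : 0 < p false by rewrite lt_def pN0.
case: (leP _ (p false / _)) => _.
  by exists (pure R (fun=> actB)); exact: avg_return_BB.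
case: (leP (1 - p false)) => _.
  by exists (pure R (fun k => if k then actT else actB)); exact: avg_return_BT.
by exists (pure R (fun=> actT)); exact: avg_return_TT.
Qed.

(** If both scalars exceed 1/2, then [p false + p true >= 1], which says that always playing B earns
    at least 1/2. *)
Lemma gadget_value_ge p : (forall k, 0 <= p k <= 1) -> 1 / 2 <= gadget_value p.
Proof.
move=> p01; rewrite /gadget_value; have [p0|pN0] := eqVneq; first lra.
have /andP[pf0 pf1] := p01 false; have /andP[pt0 pt1] := p01 true.
have pf_gt0 : 0 < p false by rewrite lt_def pN0.
rewrite !le_max; have [|pf] := leP (1 / 2) (1 - p false); first by [].
have [|pt] := leP (1 / 2) (1 - p true); first by [].
by rewrite /= ler_pdivlMr; lra.
Qed.

Lemma gadget_value_half : gadget_value (fun=> 1 / 2) = 1 / 2.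
Proof.
rewrite /gadget_value ifF; last by apply/eqP; lra.
rewrite (_ : 1 - 1 / 2 = 1 / 2 :> R); last by field.
by rewrite (_ : 1 + _ - _ = 1 :> R) ?divr1 ?maxxx//; ring.
Qed.

(** The bound on the value holds for all policies and is attained by stationary ones, so the inner
    maximum is the same for every class that contains them. *)
Lemma is_min_max_half (Pi : set (policy R state action)) :
  @stationary R state action `<=` Pi -> is_min_max (gadget R x) Pi (1 / 2)%:E.
Proof.
move=> statPi; exists (fun P => (gadget_value (death_prob P))%:E).
  move=> P /uncert_gadget[p pP]; rewrite (death_probE pP); split.
    have [d dge] := gadget_value_attained pP.
    exists (stat d); first by apply: statPi; exists d.
    by apply/eqP; rewrite eq_le dge avg_return_le_value.
  by move=> _ [pi _ <-]; exact: avg_return_le_value.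
split=> [|_ [P /uncert_gadget[p pP] <-]].
  have half01 (k : bool) : 0 <= (1 / 2 : R) <= 1 by lra.
  have [P pP] := @gadget_transition_exists R (fun=> 1 / 2) half01.
  exists P; first by apply/uncert_gadget; exists (fun=> 1 / 2).
  by rewrite (death_probE pP) gadget_value_half.
by rewrite (death_probE pP) lee_fin; apply: gadget_value_ge; case: pP.
Qed.

End gadget_value.

Theorem proposition3p9 (R : realType) (x : live_sink_reward) :
  [/\ (exists2 P : transition R state action, uncert (gadget R x) P &
        forall pi : policy R state action,
          (avg_return (gadget R x) pi P <= (1 / 2)%:E)%E),
      is_max_inf (gadget R x) (@stationary R state action) 0%E /\
      is_min_max (gadget R x) (@stationary R state action) (1 / 2)%:E &
      is_max_inf (gadget R x) (@markovian R state action) (1 / 2)%:E /\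
      is_min_max (gadget R x) (@markovian R state action) (1 / 2)%:E].
Proof.
have P0 : exists2 P : transition R state action, uncert (gadget R x) P &
    forall pi : policy R state action, (avg_return (gadget R x) pi P <= (1 / 2)%:E)%E.
  have half01 (k : bool) : 0 <= (1 / 2 : R) <= 1 by lra.
  have [P pP] := @gadget_transition_exists R (fun=> 1 / 2) half01.
  exists P; first by apply/uncert_gadget; exists (fun=> 1 / 2).
  by move=> pi; have := avg_return_le_value x pi pP; rewrite gadget_value_half.
split=> //; split; try by apply: is_min_max_half => // pi [f fE]; exists (fun=> f).
  have inf0 pi : stationary pi ->
      ereal_inf [set avg_return (gadget R x) pi P | P in uncert (gadget R x)] = 0%E.
    move=> [d dE]; apply/eqP; rewrite eq_le; apply/andP; split.
      have [P uP PE] := avg_return_stat0 x d.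
      by apply: ereal_inf_lbound; exists P => //; exact: PE.
    apply: le_ereal_inf_tmp => _ [P _ <-]; exact: avg_return_ge0 (@gadget_reward01 R x).
  split=> [|_ [pi spi <-]]; last by rewrite inf0.
  have sB : stationary (stat (pure R (fun=> actB))) by exists (pure R (fun=> actB)).
  by exists (stat (pure R (fun=> actB))) => //; exact: inf0.
have [Phalf uhalf half_le] := P0.
have inf_le pi :
    (ereal_inf [set avg_return (gadget R x) pi P | P in uncert (gadget R x)] <= (1 / 2)%:E)%E.
  by apply: le_trans (half_le pi); apply: ereal_inf_lbound; exists Phalf.
split=> [|_ [pi _ <-]]; last exact: inf_le.
exists (@gamble_policy R); first by exists (@gamble_once R).
apply/eqP; rewrite eq_le inf_le; apply: le_ereal_inf_tmp => _ [P /uncert_gadget[p pP] <-].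
exact: avg_return_gamble pP.
Qed.
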